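(* There exist universal constants $c_1, C, C'>0$ such that the following holds. Let $\bm{M}^\star=\lambda^\star\bm{u}^\star\bm{u}^{\star\top}\in\mathbb{R}^{n\times n}$ be a rank-1 symmetric matrix ($\lambda^\star\neq 0$, $\|\bm{u}^\star\|_2=1$) with incoherence parameter $\mu$, and let $\bm{M}=\bm{M}^\star+\bm{H}$, where the random noise matrix $\bm{H}$ satisfies the noise assumption with parameters $\sigma,B$ (see context). Suppose $$\max\{\sigma\sqrt{n\log n},\,B\log n\}\le c_1|\lambda^\star|.$$ Let $\lambda$ be the leading eigenvalue of $\bm{M}$. Then with probability at least $1-C'n^{-10}$, $$|\lambda-\lambda^\star|\le C\max\{\sigma\sqrt{n\log n},\,B\log n\}\sqrt{\frac{\mu}{n}}.$$
   Context: Noise assumption with parameters $\sigma=\sigma_n\ge 0$, $B=B_n>0$ on a random matrix $\bm{H}=[H_{ij}]\in\mathbb{R}^{n\times n}$: (1) the entries $H_{ij}$, $1\le i,j\le n$, are independent (no symmetry is imposed, and they need not be identically distributed); (2) $\mathbb{E}[H_{ij}]=0$; (3) $\mathrm{Var}(H_{ij})\le\sigma^2$; (4) each $H_{ij}$ satisfies either (a) $|H_{ij}|\le B$, or (b) $H_{ij}$ has a symmetric distribution with $\mathbb{P}\{|H_{ij}|>B\}\le c_{\mathrm b}n^{-12}$, where $c_{\mathrm b}>0$ is a fixed universal constant. Incoherence parameter of $\bm{M}^\star=\lambda^\star\bm{u}^\star\bm{u}^{\star\top}$: the smallest $\mu$ with $\|\bm{u}^\star\|_\infty\le\sqrt{\mu/n}$.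 The leading eigenvalue $\lambda$ of the (generally asymmetric) matrix $\bm{M}$ is its eigenvalue of largest modulus. *)

(* Defs.v *)
From HB Require Import structures.
From mathcomp Require Import all_boot all_order all_algebra.
From mathcomp Require Import all_classical all_reals all_analysis.
From mathcomp Require Import complex.
Set Implicit Arguments.
Unset Strict Implicit.
Unset Printing Implicit Defensive.
Import Order.TTheory GRing.Theory Num.Theory.
Import numFieldNormedType.Exports.
Local Open Scope classical_set_scope.
Local Open Scope ring_scope.
Local Open Scope complex_scope.

(* Mutual independence: the product rule over every finite subfamily J. *)
Definition mutually_independent (R : realType) (d : measure_display)
    (T : measurableType d) (P : probability T R) (I : finType)
    (X : I -> {RV P >-> R}) : Prop :=
  forall (J : {set I}) (A : I -> set R), (forall i, measurable (A i)) ->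
    P (\bigcap_(i in [set` J]) (X i @^-1` A i)) =
    (\prod_(i in J) P (X i @^-1` A i))%E.

Definition symmetric_distribution (R : realType) (d : measure_display)
    (T : measurableType d) (P : probability T R) (X : {RV P >-> R}) : Prop :=
  forall A : set R, measurable A ->
    P [set w | A (X w)] = P [set w | A (- X w)].

(* Since [expectation] is a total function on the extended reals, the equality
   to 0 in [noise_mean0] already forces each entry to be integrable, and
   [noise_variance] then forces square-integrability. *)
Record noise_assumption (R : realType) (d : measure_display)
    (T : measurableType d) (P : probability T R) (n : nat) (cb sigma B : R)
    (H : 'I_n -> 'I_n -> {RV P >-> R}) : Prop := {
  noise_independent :
    mutually_independent (fun ij : 'I_n * 'I_n => H ij.1 ij.2);
  noise_mean0 : forall i j, ('E_P[H i j] = 0)%E;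
  noise_variance : forall i j, ('V_P[H i j] <= (sigma ^+ 2)%:E)%E;
  noise_tail : forall i j,
    {ae P, forall w, `|H i j w| <= B} \/
    (symmetric_distribution (H i j) /\
     (P [set w | (B < `|H i j w|)%R] <= (cb * n%:R ^- 12)%:E)%E)
}.

Definition random_mx (R : realType) (d : measure_display)
    (T : measurableType d) (P : probability T R) (n : nat)
    (H : 'I_n -> 'I_n -> {RV P >-> R}) (w : T) : 'M[R]_n :=
  \matrix_(i, j) H i j w.

Definition rank1_mx (R : realType) (n : nat) (lambda : R) (u : 'cV[R]_n) :
  'M[R]_n := lambda *: (u *m u^T).

Definition l2norm (R : realType) (n : nat) (u : 'cV[R]_n) : R :=
  Num.sqrt (\sum_i u i 0 ^+ 2).

(* [`|u|] is the entrywise maximum norm [mx_norm]. *)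
Definition is_incoherence (R : realType) (n : nat) (u : 'cV[R]_n) (mu : R) :
    Prop :=
  `|u| <= Num.sqrt (mu / n%:R) /\
  forall mu' : R, `|u| <= Num.sqrt (mu' / n%:R) -> mu <= mu'.

(* The eigenvalues of a real, possibly asymmetric matrix are taken in [R[i]].
   In case of ties in modulus every maximiser is a leading eigenvalue. *)
Definition leading_eigenvalue (R : realType) (n : nat) (M : 'M[R]_n)
    (lambda : R[i]) : Prop :=
  let MC := map_mx (real_complex R) M in
  eigenvalue MC lambda /\
  forall z : R[i], eigenvalue MC z -> `|z| <= `|lambda|.

Definition noise_level (R : realType) (n : nat) (sigma B : R) : R :=
  Num.max (sigma * Num.sqrt (n%:R * ln n%:R)) (B * ln n%:R).

(* The event A need not be known to be measurable: it is asked to contain a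
   measurable event of probability at least p. *)
Definition with_probability_at_least (R : realType) (d : measure_display)
    (T : measurableType d) (P : probability T R) (p : R) (A : set T) : Prop :=
  exists E : set T, [/\ measurable E, E `<=` A & (p%:E <= P E)%E].

(* Main.v *)
Require Import Defs.
From HB Require Import structures.
From mathcomp Require Import all_boot all_order all_algebra.
From mathcomp Require Import all_classical all_reals all_analysis.
From mathcomp Require Import complex.
From mathcomp Require Import measurable_realfun.
From mathcomp Require Import ring lra zify.
Set Implicit Arguments.
Unset Strict Implicit.
Unset Printing Implicit Defensive.
Import Order.TTheory GRing.Theory Num.Theory.
Import numFieldNormedType.Exports.
Local Open Scope classical_set_scope.
Local Open Scope ring_scope.
Local Open Scope complex_scope.

(* Write M = l u u^T + H.  A left eigenvector v of M with eigenvalue z satisfies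
   z v = l (v u) u^T + v H, so iterating gives
     z = l (1 + sum_(s >= 1) u^T H^s u / z^s)
   up to a negligible remainder: it is enough that |u^T H^s u| <= sqrt (mu/n) (K L)^s
   for 1 <= s <= ln n, L being the noise level, and that the entries of H^s are at
   most n^7 (K L)^s.  The same expansion of the resolvent on the real line and the
   intermediate value theorem give an eigenvalue of modulus at least |l| / 2, hence
   a lower bound on the leading one.
   After truncation of the entries at B, both estimates follow from Markov's
   inequality for the moment of order p of a^T H^s u with m = p s of order ln n.  The
   moment is a sum over p-tuples of walks of length s in which every edge occurs at
   least twice.  Group them by pattern, i.e. by the self-map of the m steps sending
   each step to a chosen one with the same edge.  A pattern with e fixed points has
   e distinct edges and contributes at most n^e sigma^(2 e) B^(m - 2 e), which is at
   most L^m (ln n)^-(m - e); summed over all self-maps of the m steps, this gives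
   L^m (1 + (m - 1) / ln n)^m = O(L)^m. *)

(** * Neumann expansion *)

Section Neumann.
Variables (F : numFieldType) (n : nat).
Implicit Types (A : 'M[F]_n) (x : 'rV[F]_n) (u : 'cV[F]_n) (z g : F).

(** The equation is substituted into itself [N] times. Leaving [g] free serves three cases: [g = 0]
    for vectors killed by [z - A], [g = 1] for the row [u^T (z - A)^-1], and [g = l (v u)] for a
    left eigenvector [v] of the perturbed matrix. *)
Lemma neumann_expansion A x u z g N : z != 0 -> z *: x = g *: u^T + x *m A ->
  x = (g / z) *: (\sum_(s < N) z ^- s *: (u^T *m A ^+ s)) + z ^- N *: (x *m A ^+ N).
Proof.
move=> z0 Ex; elim: N => [|N IH].
  by rewrite big_ord0 scaler0 add0r expr0 invr1 scale1r mulmx1.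
rewrite {1}IH big_ord_recr /= scalerDr -addrA; congr (_ + _).
have {1}-> : x = z^-1 *: (g *: u^T + x *m A) by rewrite -Ex scalerA mulVf ?scale1r.
rewrite -scalemxAl mulmxDl -scalemxAl !scalerDr !scalerA; congr (_ + _).
  by congr (_ *: _); rewrite mulrC [z^-1 * g]mulrC.
congr (_ *: _); first by rewrite exprS invfM mulrC.
by rewrite exprS -mulmxA.
Qed.

Definition l1norm x := \sum_j `|x 0 j|.

Lemma l1norm_ge0 x : 0 <= l1norm x. Proof. exact: sumr_ge0. Qed.

Lemma l1normD x y : l1norm (x + y) <= l1norm x + l1norm y.
Proof. by rewrite -big_split; apply: ler_sum => j _; rewrite mxE ler_normD. Qed.

Lemma l1normZ c x : l1norm (c *: x) = `|c| * l1norm x.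
Proof. by rewrite mulr_sumr; apply: eq_bigr => j _; rewrite mxE normrM. Qed.

Lemma l1norm_sum N (y : 'I_N -> 'rV[F]_n) :
  l1norm (\sum_s y s) <= \sum_s l1norm (y s).
Proof.
elim/big_ind2: _ => //; first by rewrite /l1norm big1 // => j _; rewrite mxE normr0.
by move=> a a' b b' ha hb; apply: le_trans (l1normD _ _) (lerD ha hb).
Qed.

Lemma l1norm_eq0 x : l1norm x = 0 -> x = 0.
Proof.
move=> /eqP; rewrite psumr_eq0 // => /allP h; apply/rowP => j; rewrite mxE.
by apply/eqP; rewrite -normr_eq0; apply: h; rewrite mem_index_enum.
Qed.

Lemma normr_mulmx_le x u c : (forall i, `|u i 0| <= c) ->
  `|(x *m u) 0 0| <= c * l1norm x.
Proof.
move=> hu; rewrite mxE mulr_sumr (le_trans (ler_norm_sum _ _ _))//.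
by apply: ler_sum => i _; rewrite normrM mulrC ler_wpM2r.
Qed.

Lemma l1norm_mulmx_le x A c : (forall i j, `|A i j| <= c) ->
  l1norm (x *m A) <= n%:R * c * l1norm x.
Proof.
move=> hA; apply: (@le_trans _ _ (\sum_(j < n) c * l1norm x)).
  apply: ler_sum => j _.
  have -> : (x *m A) 0 j = (x *m col j A) 0 0.
    by rewrite !mxE; apply: eq_bigr => i _; rewrite mxE.
  by apply: normr_mulmx_le => i; rewrite mxE.
by rewrite sumr_const card_ord -mulrA mulr_natl.
Qed.

Lemma sum_geometric_le (q : F) N : 0 <= q -> 2 * q <= 1 -> \sum_(s < N) q ^+ s <= 2.
Proof.
move=> q0 q1; suff h : (1 - q) * \sum_(s < N) q ^+ s <= 1.
  have hS : 0 <= \sum_(s < N) q ^+ s by apply: sumr_ge0 => s _; rewrite exprn_ge0.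
  have h2 : 2 * ((1 - q) * \sum_(s < N) q ^+ s) <= 2 * 1 by rewrite ler_wpM2l.
  rewrite mulr1 in h2; apply: le_trans h2; rewrite mulrA -[leLHS]mul1r ler_wpM2r//.
  by rewrite mulrBr mulr1 lerBrDr -lerBrDl (_ : 2 - 1 = 1) //; ring.
by rewrite -[1 - q]opprB mulNr -subrX1 opprB gerBl exprn_ge0.
Qed.

(** The crude entrywise bound [b * rho ^+ s] only controls [l1norm x] and the remainder, where
    powers of [q] beat those of [n] and [b]; the sharp factor [ups] comes from the forms
    [u^T A^s u]. The field is general because both [R] and [R[i]] occur. *)
Lemma neumann_bounds A x u z g (b rho ups q : F) N :
  (0 < N)%N -> z != 0 -> 1 <= b -> 0 <= rho -> 0 <= ups -> rho = q * `|z| ->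
  2 * q <= 1 -> 2 * (n%:R * b * q ^+ N) <= 1 ->
  4 * (n%:R ^+ 3 * b ^+ 2 * q ^+ N.-1) <= ups ->
  (u^T *m u) 0 0 = 1 ->
  (forall i, `|u i 0| <= 1) ->
  (forall s i j, (s <= N)%N -> `|(A ^+ s) i j| <= b * rho ^+ s) ->
  (forall s, (0 < s < N)%N -> `|(u^T *m A ^+ s *m u) 0 0| <= ups * rho ^+ s) ->
  z *: x = g *: u^T + x *m A ->
  `|z| * l1norm x <= 4 * n%:R ^+ 2 * b * `|g| /\
  `|z * (x *m u) 0 0 - g| <= 3 * ups * q * `|g|.
Proof.
move=> N0 z0 b1 rho0 ups0 Erho q1 hb hups uu hu hA hy Ex.
have nz0 : 0 < `|z| by rewrite normr_gt0.
have q0 : 0 <= q by rewrite -(pmulr_lge0 _ nz0) -Erho.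
have b0 : 0 <= b by apply: le_trans b1.
have rhoz s : `|z ^- s| * rho ^+ s = q ^+ s.
  by rewrite normfV normrX Erho exprMn mulrCA mulVf ?mulr1// expf_neq0// gt_eqF.
have l1u : l1norm u^T <= n%:R.
  rewrite /l1norm -[n in leRHS]card_ord -sumr_const.
  by apply: ler_sum => i _; rewrite mxE hu.
have Exp := neumann_expansion N z0 Ex.
have tail : l1norm (z ^- N *: (x *m A ^+ N)) <= n%:R * b * q ^+ N * l1norm x.
  rewrite l1normZ; apply: (@le_trans _ _ (`|z ^- N| * (n%:R * (b * rho ^+ N) * l1norm x))).
    by rewrite ler_wpM2l// l1norm_mulmx_le// => i j; apply: hA.
  by rewrite -(rhoz N) le_eqVlt; apply/orP; left; apply/eqP; ring.
have l1x : `|z| * l1norm x <= 4 * n%:R ^+ 2 * b * `|g|.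
  have h1 : l1norm x <= `|g| / `|z| * (n%:R ^+ 2 * b * 2) + n%:R * b * q ^+ N * l1norm x.
    rewrite {1}Exp; apply: le_trans (l1normD _ _) _; apply: lerD tail.
    rewrite l1normZ normrM normfV ler_wpM2l ?divr_ge0//.
    apply: (le_trans (l1norm_sum _)).
    apply: (@le_trans _ _ (\sum_(s < N) n%:R ^+ 2 * b * q ^+ s)); last first.
      by rewrite -mulr_sumr ler_wpM2l ?mulr_ge0 ?exprn_ge0 ?ler0n// sum_geometric_le.
    apply: ler_sum => s _; rewrite l1normZ.
    apply: (@le_trans _ _ (`|z ^- s| * (n%:R * (b * rho ^+ s) * n%:R))).
      rewrite ler_wpM2l//; apply: le_trans (_ : n%:R * (b * rho ^+ s) * l1norm u^T <= _).
        by rewrite l1norm_mulmx_le// => i j; apply: hA; apply: ltnW.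
      by rewrite ler_wpM2l// !mulr_ge0 ?exprn_ge0 ?ler0n.
    by rewrite -(rhoz s) le_eqVlt; apply/orP; left; apply/eqP; ring.
  (* The remainder is at most half of [l1norm x] and is absorbed into the left-hand side. *)
  have h2 : 2 * (n%:R * b * q ^+ N) * l1norm x <= 1 * l1norm x.
    by rewrite ler_wpM2r// l1norm_ge0.
  have h3 : l1norm x <= 4 * n%:R ^+ 2 * b * `|g| / `|z|.
    have -> : 4 * n%:R ^+ 2 * b * `|g| / `|z| = 2 * (`|g| / `|z| * (n%:R ^+ 2 * b * 2)) by ring.
    have h1' := ler_wpM2l (ler0n F 2) h1.
    rewrite mul1r in h2; rewrite mulrDr in h1'.
    rewrite -(lerD2r (l1norm x)); apply: le_trans (_ : 2 * l1norm x <= _).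
      by rewrite mulr_natl mulr2n.
    by apply: (le_trans h1'); rewrite lerD2l mulrA.
  by rewrite mulrC -ler_pdivlMr.
split=> //.
(* The term [s = 0] is exactly [g] because [u^T u = 1]; the difference starts at [s = 1], hence the
   factor [q] in the bound. *)
have Ezu : z * (x *m u) 0 0 - g = g * (\sum_(1 <= s < N) z ^- s * (u^T *m A ^+ s *m u) 0 0)
   + z * ((z ^- N *: (x *m A ^+ N)) *m u) 0 0.
  rewrite {1}Exp mulmxDl mxE mulrDr addrAC; congr (_ + _).
  rewrite -scalemxAl mxE mulrA mulrCA mulfV// mulr1 mulmx_suml summxE.
  rewrite -(big_mkord xpredT (fun s => (z ^- s *: (u^T *m A ^+ s) *m u) 0 0)).
  rewrite big_ltn// mulrDr -scalemxAl mxE expr0 invr1 mul1r mulmx1 uu mulr1 addrC addKr.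
  by congr (_ * _); apply: eq_bigr => s _; rewrite -scalemxAl mxE.
rewrite Ezu; apply: le_trans (ler_normD _ _) _.
have -> : 3 * ups * q * `|g| = `|g| * (ups * q * 2) + ups * q * `|g| by ring.
apply: lerD.
  rewrite normrM ler_wpM2l//; apply: le_trans (ler_norm_sum _ _ _) _.
  apply: (@le_trans _ _ (\sum_(1 <= s < N) ups * q * q ^+ s.-1)).
    rewrite big_nat [leRHS]big_nat; apply: ler_sum => s hs; rewrite normrM.
    apply: le_trans (_ : `|z ^- s| * (ups * rho ^+ s) <= _).
      by rewrite ler_wpM2l// hy.
    by rewrite mulrCA rhoz -mulrA -exprS prednK//; case/andP: hs.
  rewrite -mulr_sumr ler_wpM2l ?mulr_ge0// big_add1 big_mkord.
  exact: sum_geometric_le.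
rewrite normrM.
apply: (@le_trans _ _ (`|z| * (n%:R * b * q ^+ N * l1norm x))).
  rewrite ler_wpM2l//; apply: le_trans (normr_mulmx_le _ hu) _.
  by rewrite mul1r.
rewrite mulrCA; apply: (@le_trans _ _ (n%:R * b * q ^+ N * (4 * n%:R ^+ 2 * b * `|g|))).
  by rewrite ler_wpM2l// !mulr_ge0 ?exprn_ge0 ?ler0n.
have -> : n%:R * b * q ^+ N * (4 * n%:R ^+ 2 * b * `|g|) =
          4 * (n%:R ^+ 3 * b ^+ 2 * q ^+ N.-1) * (q * `|g|).
  by rewrite -{1}(prednK N0) exprS; ring.
by rewrite -(mulrA ups) ler_wpM2r// mulr_ge0.
Qed.

End Neumann.

(** * Eigenvalues of a perturbed rank-1 matrix *)

Section LeadingEigenvalue.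
Variables (R : realType) (n : nat).
Implicit Types (A : 'M[R]_n) (u : 'cV[R]_n) (z : R).

Lemma map_horner_char_poly_mx A z :
  map_mx (horner_eval z) (char_poly_mx A) = z%:M - A.
Proof.
apply/matrixP => i j; rewrite !mxE /horner_eval /= hornerD hornerN hornerC hornerMn hornerX.
by [].
Qed.

Lemma horner_char_poly A z : (char_poly A).[z] = \det (z%:M - A).
Proof. by rewrite -map_horner_char_poly_mx det_map_mx. Qed.

(** By the matrix determinant lemma this is the characteristic polynomial of [l u u^T + A]. In
    polynomial form the intermediate value theorem applies without a continuity argument for the
    resolvent. *)
Definition rank1_poly A u (l : R) : {poly R} :=
  char_poly A - l *: \sum_j \sum_i (u i 0 * u j 0) *: (\adj (char_poly_mx A)) i j.

Lemma horner_rank1_poly A u l z : z%:M - A \in unitmx ->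
  (rank1_poly A u l).[z] =
  (char_poly A).[z] * (1 - l * (u^T *m invmx (z%:M - A) *m u) 0 0).
Proof.
move=> uA; rewrite hornerD hornerN hornerZ mulrBr mulr1; congr (_ - _).
rewrite mulrCA; congr (_ * _).
have -> : u^T *m invmx (z%:M - A) *m u =
   (\det (z%:M - A))^-1 *: (u^T *m \adj (z%:M - A) *m u).
  by rewrite /invmx uA -scalemxAr -scalemxAl.
rewrite mxE mulrA horner_char_poly mulfV ?mul1r; last first.
  by move: uA; rewrite unitmxE unitfE.
rewrite horner_sum mxE; apply: eq_bigr => j _.
rewrite horner_sum mxE mulr_suml -map_horner_char_poly_mx -map_mx_adj.
by apply: eq_bigr => i _; rewrite hornerZ !mxE mulrAC.
Qed.

(** The direction of the sign change is left open, since the sign of [char_poly A] at the end points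
    is unknown. *)
Lemma poly_ivt_mul (p : {poly R}) (a b : R) : a <= b -> p.[a] * p.[b] <= 0 ->
  exists2 x, a <= x <= b & root p x.
Proof.
move=> ab pab; have [pa|pa] := lerP p.[a] 0.
  have [pb|pb] := lerP 0 p.[b]; first by apply: poly_ivt => //; rewrite pa pb.
  have pa0 : p.[a] = 0.
    by apply/eqP; rewrite eq_le pa /= -(nmulr_lle0 _ pb).
  by exists a; rewrite ?lexx ?ab// rootE pa0.
have pb : p.[b] <= 0 by rewrite -(pmulr_rle0 _ pa).
have [|x xab] := @poly_ivt _ (- p) _ _ ab; first by rewrite !hornerN oppr_le0 oppr_ge0 ltW.
by rewrite rootN; exists x.
Qed.

Lemma resolvent_eq A u z : z%:M - A \in unitmx ->
  z *: (u^T *m invmx (z%:M - A)) = 1 *: u^T + u^T *m invmx (z%:M - A) *m A.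
Proof.
move=> uA; set x := u^T *m _.
have : x *m (z%:M - A) = u^T by rewrite mulmxKV.
by rewrite mulmxBr mul_mx_scalar scale1r => <-; rewrite subrK.
Qed.

Variables (A : 'M[R]_n) (u : 'cV[R]_n) (l b rho ups : R) (N : nat).
(** The value of [rho / |z|] at [|z| = |l| / 2], the smallest modulus considered; the smallness
    assumptions on [q] pass to larger [|z|] by monotonicity. *)
Let q := 2 * rho / `|l|.
Hypotheses (l0 : l != 0) (N0 : (0 < N)%N) (b1 : 1 <= b) (rho0 : 0 <= rho)
  (ups0 : 0 <= ups) (ups1 : ups <= 1) (q_small : 12 * q <= 1)
  (q_N : 2 * (n%:R * b * q ^+ N) <= 1)
  (q_N1 : 4 * (n%:R ^+ 3 * b ^+ 2 * q ^+ N.-1) <= ups)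
  (uu : (u^T *m u) 0 0 = 1) (u1 : forall i, `|u i 0| <= 1)
  (hA : forall s i j, (s <= N)%N -> `|(A ^+ s) i j| <= b * rho ^+ s)
  (hy : forall s, (0 < s < N)%N -> `|(u^T *m A ^+ s *m u) 0 0| <= ups * rho ^+ s).

Let q0 : 0 <= q. Proof. by rewrite divr_ge0// mulr_ge0. Qed.

Let ratio_le_q r : `|l| <= 2 * r -> 0 < r /\ rho / r <= q.
Proof.
move=> hr; have l0' : 0 < `|l| by rewrite normr_gt0.
have r0 : 0 < r by rewrite -(@pmulr_rgt0 _ 2)// (lt_le_trans _ hr).
split=> //; rewrite ler_pdivrMr// /q mulrAC ler_pdivlMr// -mulrA mulrCA ler_wpM2l//.
Qed.

Let ratio_le r : `|l| <= 2 * r ->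
  [/\ 0 < r, 0 <= rho / r, 2 * (rho / r) <= 1,
     2 * (n%:R * b * (rho / r) ^+ N) <= 1 &
  4 * (n%:R ^+ 3 * b ^+ 2 * (rho / r) ^+ N.-1) <= ups].
Proof.
move=> /ratio_le_q[r0 rq].
have r0' : 0 <= rho / r by rewrite divr_ge0// ltW.
have b0 : 0 <= b by apply: le_trans b1.
have h12 : 12 * (rho / r) <= 1 by apply: le_trans q_small; rewrite ler_wpM2l.
split=> //.
- lra.
- by apply: le_trans q_N; rewrite ler_wpM2l// ler_wpM2l ?mulr_ge0 ?ler0n// lerXn2r.
- apply: le_trans q_N1.
  by rewrite ler_wpM2l// ler_wpM2l ?mulr_ge0 ?exprn_ge0 ?ler0n// lerXn2r.
Qed.

Let bounds z g x : `|l| <= 2 * `|z| -> z *: x = g *: u^T + x *m A ->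
  `|z| * l1norm x <= 4 * n%:R ^+ 2 * b * `|g| /\
  `|z * (x *m u) 0 0 - g| <= 3 * ups * (rho / `|z|) * `|g|.
Proof.
move=> hz; have [z0 p0 p1 p3 p4] := ratio_le hz.
apply: (neumann_bounds N0 _ b1 rho0 ups0 _ p1 p3 p4 uu u1 hA hy).
  by rewrite -normr_gt0.
by rewrite divfK// gt_eqF.
Qed.

(** A row vector killed by [z - A] solves the Neumann equation with [g = 0], and the first bound
    makes it vanish. *)
Let resolvent_unit z : `|l| <= 2 * `|z| -> z%:M - A \in unitmx.
Proof.
move=> hz; rewrite -row_free_unit; apply: inj_row_free => v.
rewrite mulmxBr mul_mx_scalar => /eqP; rewrite subr_eq0 => /eqP hv.
have [|h _] := @bounds z 0 v hz; first by rewrite scale0r add0r.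
have [z0 _ _ _ _] := ratio_le hz.
apply: l1norm_eq0; apply/eqP; rewrite eq_le l1norm_ge0 andbT.
by rewrite normr0 mulr0 pmulr_rle0 in h.
Qed.

Let resolvent_bound z : `|l| <= 2 * `|z| ->
  `|z * (u^T *m invmx (z%:M - A) *m u) 0 0 - 1| <= 4^-1.
Proof.
move=> hz; have [_ h] := bounds hz (resolvent_eq u (resolvent_unit hz)).
have [z0 p0 p1 p3 p4] := ratio_le hz.
have p2 : 12 * (rho / `|z|) <= 1.
  apply: le_trans q_small; rewrite ler_wpM2l//; by have [] := ratio_le_q hz.
rewrite normr1 mulr1 in h.
have : ups * (rho / `|z|) <= 1 * (rho / `|z|) by rewrite ler_wpM2r.
rewrite mul1r -mulrA in h *; lra.
Qed.

Let l_scaled (t : R) : 2^-1 <= t -> `|l| <= 2 * `|l * t|.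
Proof.
move=> ht; rewrite normrM mulrCA; rewrite -[leLHS]mulr1 ler_wpM2l//.
by rewrite ger0_norm; lra.
Qed.

(** The substitution [z = l t], with [t] from [1 / 2] to [2], treats both signs of [l]. The factor
    [1 - l u^T (z - A)^-1 u] is close to [1 - 1 / t], hence negative at [1 / 2] and positive at [2];
    a zero of it makes [u^T (z - A)^-1] a left eigenvector. *)
Lemma rank1_real_eigenvalue : exists2 z : R,
  eigenvalue (rank1_mx l u + A) z & `|l| <= 2 * `|z|.
Proof.
pose S : {poly R} := l *: 'X.
have hS t (p : {poly R}) : (p \Po S).[t] = p.[l * t].
  by rewrite horner_comp hornerZ hornerX.
have cp0 t : 2^-1 <= t -> (char_poly A).[l * t] != 0.
  move=> ht; have := resolvent_unit (l_scaled ht).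
  by rewrite unitmxE unitfE horner_char_poly.
(* Having no root in between, [char_poly A] keeps its sign, so the sign change must come from the
   other factor. *)
have cpp : 0 < (char_poly A).[l * 2^-1] * (char_poly A).[l * 2].
  rewrite ltNge; apply/negP => h.
  have [||t /andP[ht _]] := @poly_ivt_mul (char_poly A \Po S) 2^-1 2; first lra.
    by rewrite !hS.
  by rewrite rootE hS; apply/negP; apply: cp0.
have [||t /andP[ht _]] := @poly_ivt_mul (rank1_poly A u l \Po S) 2^-1 2; first lra.
  have a1 : 2^-1 <= 2^-1 :> R by [].
  have a2 : 2^-1 <= 2 :> R by lra.
  rewrite !hS !horner_rank1_poly ?resolvent_unit ?l_scaled// mulrACA.
  rewrite pmulr_rle0//.
  have := resolvent_bound (l_scaled a1); have := resolvent_bound (l_scaled a2).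
  set y1 := (u^T *m invmx ((l * 2)%:M - A) *m u) 0 0.
  set y2 := (u^T *m invmx ((l / 2)%:M - A) *m u) 0 0.
  rewrite !ler_norml => /andP[h1 h2] /andP[h3 h4].
  by rewrite nmulr_rle0; lra.
rewrite rootE hS horner_rank1_poly ?resolvent_unit ?l_scaled// mulf_eq0.
rewrite (negbTE (cp0 _ ht)) /= subr_eq0 => /eqP hx.
exists (l * t); last exact: l_scaled.
have := resolvent_eq u (resolvent_unit (l_scaled ht)).
set x := u^T *m _ in hx * => ex.
apply/eigenvalueP; exists x.
  rewrite ex mulmxDr /rank1_mx -scalemxAr mulmxA; congr (_ + _).
  by rewrite [x *m u]mx11_scalar mul_scalar_mx scalerA -hx.
apply/eqP => x0; move: hx; rewrite x0 mul0mx mxE mulr0 => /eqP.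
by rewrite oner_eq0.
Qed.

Local Notation rc := (real_complex R).

(** Since [|z| >= |l| / 2], the Neumann bounds apply over [R[i]] to a left eigenvector [v], with
    [g = l c] and [c = v u]. Dividing the second bound by [|c|] leaves [3 * ups * p * |l|] with
    [p = rho / |z|], and [p * |l| <= 2 * rho]. *)
Lemma rank1_leading_eigenvalue (z : R[i]) :
  leading_eigenvalue (rank1_mx l u + A) z -> `|z - l%:C| <= (6 * ups * rho)%:C.
Proof.
move=> [/eigenvalueP[v hv v0] zmax].
have [x0 /eigenvalueP[x hx xn0] lx0] := rank1_real_eigenvalue.
have {}zmax : `|x0%:C| <= `|z|.
  apply: zmax; apply/eigenvalueP; exists (map_mx rc x).
    by rewrite -map_mxM hx map_mxZ.
  by rewrite map_mx_eq0.
have [r zr] : exists r : R, `|z| = r%:C by rewrite normc_def; eexists.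
have lr : `|l| <= 2 * r.
  apply: le_trans lx0 _; rewrite ler_wpM2l//.
  by rewrite zr normc_def lecR /= expr0n /= addr0 sqrtr_sqr in zmax.
have [r0 p0 p1 p3 p4] := ratio_le lr.
have normC (y : R) : `|y%:C| = `|y|%:C.
  by rewrite normc_def /= expr0n /= addr0 sqrtr_sqr.
have ler0C (y : R) : 0 <= y -> 0 <= y%:C by rewrite -lecR.
pose c := (v *m map_mx rc u) 0 0.
have ev : z *: v = (l%:C * c) *: (map_mx rc u)^T + v *m map_mx rc A.
  rewrite -hv map_mxD mulmxDr; congr (_ + _).
  rewrite /rank1_mx map_mxZ map_mxM -scalemxAr mulmxA [v *m _]mx11_scalar.
  by rewrite mul_scalar_mx scalerA map_trmx.
have mapX s : map_mx rc A ^+ s = map_mx rc (A ^+ s) by rewrite rmorphXn.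
have Erho : rho = rho / r * r by rewrite divfK// gt_eqF.
set p := rho / r in p0 p1 p3 p4 Erho; clearbody p.
have castle (x1 x2 : R) : x1 <= x2 -> rc x1 <= rc x2 by rewrite lecR.
have entry (B : 'M[R]_1) : map_mx rc B 0 0 = rc (B 0 0) by rewrite mxE.
have z0 : z != 0 by rewrite -normr_gt0 zr ltcR.
have [] := @neumann_bounds _ n (map_mx rc A) v (map_mx rc u) z (l%:C * c)
  (rc b) (rc rho) (rc ups) (rc p) N N0 z0.
- by have := castle _ _ b1; rewrite rmorph1.
- by have := castle _ _ rho0; rewrite rmorph0.
- by have := castle _ _ ups0; rewrite rmorph0.
- by rewrite zr -rmorphM -Erho.
- by have := castle _ _ p1; rewrite rmorphM rmorph_nat rmorph1.
- by have := castle _ _ p3; rewrite !rmorphM rmorphXn !rmorph_nat rmorph1.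
- by have := castle _ _ p4; rewrite !rmorphM !rmorphXn !rmorph_nat.
- by rewrite map_trmx -map_mxM entry uu rmorph1.
- by move=> i; rewrite mxE normC; have := castle _ _ (u1 i); rewrite rmorph1.
- move=> s i j hs; rewrite mapX mxE normC.
  by have := castle _ _ (hA i j hs); rewrite rmorphM rmorphXn.
- move=> s hs; rewrite mapX map_trmx -!map_mxM entry normC.
  by have := castle _ _ (hy hs); rewrite rmorphM rmorphXn.
- exact: ev.
rewrite -/c => hl1 hc.
(* If [c] were zero, the first bound would force [v = 0]. *)
have c0 : c != 0.
  apply/eqP => c0; move/negP: v0; apply; apply/eqP/l1norm_eq0/eqP.
  rewrite c0 mulr0 normr0 mulr0 pmulr_rle0 ?normr_gt0// in hl1.
  by rewrite eq_le hl1 l1norm_ge0.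
have {hc} : `|z - l%:C| * `|c| <= 3 * rc ups * rc p * `|l%:C| * `|c|.
  by rewrite -normrM mulrBl -mulrA -normrM.
rewrite ler_pM2r ?normr_gt0// => /le_trans; apply.
rewrite normC -[3](rmorph_nat rc) -!rmorphM lecR.
have : ups * p * `|l| <= ups * p * (2 * r) by rewrite ler_wpM2l// mulr_ge0.
by rewrite Erho; lra.
Qed.

End LeadingEigenvalue.

(** * Counting walks with a given coincidence pattern *)

Section WalkCounting.
Variables (n p s : nat).
Local Notation walks := {ffun 'I_p -> {ffun 'I_s.+1 -> 'I_n}}.
Local Notation step := ('I_p * 'I_s)%type.
Implicit Types (w : walks) (x y : step) (r : 'I_p).

(** Positions are natural numbers, so that [t.+1] needs no cast; only [t <= s] is meaningful. *)
Definition vertex w r (t : nat) : 'I_n := w r (inord t).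

Definition edge w x : 'I_n * 'I_n := (vertex w x.1 x.2, vertex w x.1 x.2.+1).

Variable kappa : step -> step.

(** Different fibres of [kappa] may carry the same edge: this is weaker than having pattern [kappa],
    and only enlarges the sums to be bounded. *)
Definition consistent w := [forall x, edge w (kappa x) == edge w x].

Lemma consistentP w x y : consistent w -> kappa x = kappa y -> edge w x = edge w y.
Proof.
by move=> /forallP h e; rewrite -(eqP (h x)) e (eqP (h y)).
Qed.

(** * Reconstruction of walks along an order of their steps *)

Section Order.
Variable late : pred 'I_p.

(** With the family [late] placed after its complement, a step shared between the two is always a
    repetition for the late walk. *)
Definition walk_rank r : nat := late r * p + r.

Lemma walk_rank_inj : injective walk_rank.
Proof.
rewrite /walk_rank => r r'; case: (late r) (late r') => [] [] /=;
  rewrite ?mul1n ?mul0n ?add0n => /eqP.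
- by rewrite eqn_add2l => /eqP/val_inj.
- by rewrite gtn_eqF// (leq_trans (ltn_ord r'))// leq_addr.
- by rewrite ltn_eqF// (leq_trans (ltn_ord r))// leq_addr.
- by move=> /eqP/val_inj.
Qed.

Definition precedes x y :=
  (walk_rank x.1 < walk_rank y.1)%N || (x.1 == y.1) && (x.2 < y.2)%N.

Lemma precedes_total x y : ~~ precedes x y -> ~~ precedes y x -> x = y.
Proof.
case: x y => [r t] [r' t']; rewrite /precedes /= !negb_or -!leqNgt.
move=> /andP[h1 h2] /andP[h3 h4].
have rr : r = r' by apply: walk_rank_inj; apply/eqP; rewrite eqn_leq h1 h3.
move: h2 h4; rewrite rr eqxx /= -!leqNgt => h2 h4.
by congr (_, _); apply/val_inj/eqP; rewrite eqn_leq h2 h4.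
Qed.

Definition first x := [forall y, (kappa y == kappa x) ==> ~~ precedes y x].

Lemma not_firstP x : reflect (exists2 y, kappa y = kappa x & precedes y x) (~~ first x).
Proof.
rewrite negb_forall; apply: (iffP existsP) => [[y]|[y e h]].
  by rewrite negb_imply negbK => /andP[/eqP]; exists y.
by exists y; rewrite negb_imply negbK e eqxx.
Qed.

(** Distinct first steps lie in distinct fibres of [kappa], and by idempotence the values of [kappa]
    are fixed points. *)
Lemma card_first_le : (forall x, kappa (kappa x) = kappa x) ->
  (#|[pred x | first x]| <= #|[pred x | kappa x == x]|)%N.
Proof.
move=> idem; rewrite -(@card_in_imset _ _ kappa [pred x | first x]).
  apply: subset_leq_card; apply/fintype.subsetP => y /imsetP[x _ ->].
  by rewrite inE idem.
move=> x y; rewrite !inE => /forallP hx /forallP hy e.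
apply: precedes_total; first by have /implyP := hy x; apply; apply/eqP.
by have /implyP := hx y; apply; apply/eqP.
Qed.

Variable S : {set 'I_p}.

(* A walk outside [S] is recovered from its first repeated step: backwards from
   there by the tails of the preceding steps, forwards by heads. *)
Definition stored w x : 'I_n :=
  if (x.1 \notin S) && [forall t : 'I_s, (t <= x.2)%N ==> first (x.1, t)]
  then vertex w x.1 x.2 else vertex w x.1 x.2.+1.

Hypothesis repeated : forall r, r \notin S -> exists t, ~~ first (r, t).

(** Induction on the rank. A walk in [S] is followed forwards from its given start. One outside [S]
    needs no start: its first repeated step copies a known edge, whose tail joins the stored tails
    to the stored heads. This saves a factor [n] per such walk. *)
Lemma walks_recovered w w' : consistent w -> consistent w' ->
  (forall r, r \in S -> vertex w r 0 = vertex w' r 0) ->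
  (forall x, first x -> stored w x = stored w' x) -> w = w'.
Proof.
move=> cw cw' hS hst.
suff h m r : (walk_rank r < m)%N -> forall t, (t <= s)%N -> vertex w r t = vertex w' r t.
  apply/ffunP => r; apply/ffunP => t.
  have := h _ r (ltnSn _) t; rewrite /vertex inord_val; apply.
  by rewrite -ltnS.
elim: m r => [//|m IH] r hr.
(* A repeated step copies its edge from a preceding one, known by induction in a walk of smaller
   rank, and from earlier positions in the same walk. *)
have step_eq x y : precedes y x -> x.1 = r -> kappa y = kappa x ->
    (y.1 = r -> vertex w r y.2 = vertex w' r y.2 /\ vertex w r y.2.+1 = vertex w' r y.2.+1) ->
    edge w x = edge w' x.
  case: x y => [r1 t] [r' t'] /= lt_yx er; rewrite {r1}er in lt_yx * => e hy.
  rewrite -(consistentP cw e) -(consistentP cw' e) /edge /=.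
  move: lt_yx; rewrite /precedes /= => /orP[lt_r|/andP[/eqP er _]].
    have lt_m : (walk_rank r' < m)%N by apply: leq_trans lt_r _; rewrite -ltnS.
    by rewrite !(IH _ lt_m)// ltnW.
  by rewrite er in hy *; have [-> ->] := hy erefl.
(* From [t0] on, first steps store heads: [t0] is 0 for a walk in [S], and the position of the first
   repeated step otherwise. *)
suff [t0 [le_t0 ht0 hfst]] : exists t0 : nat, [/\ (t0 <= s)%N,
    forall t, (t <= t0)%N -> vertex w r t = vertex w' r t &
    forall t : 'I_s, (t0 <= t)%N -> first (r, t) ->
      (r \notin S) && [forall t' : 'I_s, (t' <= t)%N ==> first (r, t')] = false].
  move=> t; have [/ht0 //|lt_t0] := leqP t t0.
  move: t lt_t0; apply: (@ltn_ind (fun t => (t0 < t)%N -> (t <= s)%N -> _)) => -[//|t] IHt lt_t le_t.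
  have IHt' t' : (t' <= t)%N -> vertex w r t' = vertex w' r t'.
    have [/ht0 //|h1 h2] := leqP t' t0; apply: IHt => //.
    by apply: leq_trans (ltnW le_t).
  have [fst|/not_firstP[y e lt_y]] := boolP (first (r, Ordinal le_t)).
    by have := hst _ fst; rewrite /stored hfst.
  suff [] : edge w (r, Ordinal le_t) = edge w' (r, Ordinal le_t) by [].
  apply: (step_eq _ _ lt_y _ e) => //= ey.
  have lt_yt : (y.2 < t)%N.
    by move: lt_y; rewrite /precedes /= ey ltnn eqxx.
  by split; apply: IHt' => //; apply: ltnW.
have [rS|rS] := boolP (r \in S).
  exists 0%N; split=> // t; rewrite leqn0 => /eqP->; exact: hS.
have ex : exists t, (t < s)%N && [exists t' : 'I_s, (val t' == t) && ~~ first (r, t')].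
  have [t ht] := repeated rS; exists t; rewrite ltn_ord.
  by apply/existsP; exists t; rewrite eqxx.
case: (ex_minnP ex) => t0 /andP[lt_t0 /existsP[t1 /andP[/eqP et1 nf]]] min_t0.
have before (t : 'I_s) : (t < t0)%N -> first (r, t).
  apply: contraTT => h; rewrite -leqNgt; apply: min_t0; rewrite ltn_ord.
  by apply/existsP; exists t; rewrite eqxx.
have ht0 t : (t < t0)%N -> vertex w r t = vertex w' r t.
  move=> lt_t; have lt_s := ltn_trans lt_t lt_t0.
  have := hst (r, Ordinal lt_s) (before (Ordinal lt_s) lt_t); rewrite /stored /= rS.
  suff -> : [forall t' : 'I_s, (t' <= t)%N ==> first (r, t')] by [].
  by apply/forallP => t'; apply/implyP => le_t'; apply: before; apply: leq_ltn_trans lt_t.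
have et0 : vertex w r t0 = vertex w' r t0.
  have /not_firstP[[r' t'] e lt_y] := nf.
  have lt_t' : r' = r -> (t' < t0)%N.
    by move=> er; move: lt_y; rewrite /precedes /= er ltnn eqxx /= et1.
  have /= er' := consistentP cw e; have /= er'' := consistentP cw' e.
  have [er|ner] := eqVneq r' r.
    have := lt_t' er; rewrite er /edge /= et1 in er' er'' * => lt.
    by case: er' => <- _; case: er'' => <- _; apply: ht0.
  suff : edge w (r, t1) = edge w' (r, t1) by rewrite /edge /= et1 => -[].
  apply: (step_eq _ _ lt_y _ e) => //= er; by rewrite er eqxx in ner.
exists t0; split.
- exact: ltnW.
- by move=> t; rewrite leq_eqVlt => /orP[/eqP->|/ht0].
- move=> t le_t _ /=; apply/negP => /forallP /(_ t1).
  by rewrite et1 le_t /= (negbTE nf).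
Qed.

(** Consistent tuples inject into pairs made of the starts of the walks in [S] and one stored vertex
    per first step. The starts have total weight at most 1, and each first step costs a factor
    [n]. *)
Lemma sum_walks_late (R : realFieldType) (c : 'I_n -> R) :
  (0 < n)%N -> (forall i, 0 <= c i) -> \sum_i c i <= 1 ->
  (forall x, kappa (kappa x) = kappa x) ->
  \sum_(w | consistent w) \prod_(r in S) c (vertex w r 0) <=
    n%:R ^+ #|[pred x | kappa x == x]|.
Proof.
move=> n0 c0 c1 idem.
pose X := {r | r \in S}; pose Y := {x | first x}.
pose Phi w : {ffun X -> 'I_n} * {ffun Y -> 'I_n} :=
  ([ffun r => vertex w (val r) 0], [ffun x => stored w (val x)]).
have Phi_inj : {in [pred w | consistent w] &, injective Phi}.
  move=> w w'; rewrite !inE => cw cw' [/ffunP e1 /ffunP e2].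
  apply: walks_recovered => // [r hr|x hx].
    by have := e1 (exist _ r hr); rewrite !ffunE.
  by have := e2 (exist _ x hx); rewrite !ffunE.
pose G (y : {ffun X -> 'I_n} * {ffun Y -> 'I_n}) := \prod_r c (y.1 r).
have G0 z : 0 <= G z by apply: prodr_ge0.
apply: (@le_trans _ _ (\sum_y G y)).
  rewrite [leRHS](bigID [pred y | y \in Phi @: [pred w | consistent w]]) /=.
  rewrite big_imset //= ler_wpDr ?sumr_ge0//.
  by apply: ler_sum => w _; rewrite big_sub /G; under [leRHS]eq_bigr do rewrite ffunE.
rewrite -(pair_bigA _ (fun f g => G (f, g))) /=.
rewrite (eq_bigr (fun f : {ffun X -> 'I_n} => (\prod_r c (f r)) *+ #|{ffun Y -> 'I_n}|)); last first.
  by move=> f _; rewrite -sumr_const; apply: eq_bigl.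
rewrite sumrMnl -(bigA_distr_bigA (fun _ : X => c)) /= prodr_const card_ffun card_ord.
rewrite !card_sig -[leLHS]mulr_natl natrX -[leRHS]mulr1; apply: ler_pM.
- by rewrite exprn_ge0.
- by rewrite exprn_ge0// sumr_ge0.
- by rewrite ler_weXn2l ?ler1n// card_first_le.
- by rewrite exprn_ile1// sumr_ge0.
Qed.

End Order.

Section Bound.
Variables (R : realFieldType) (a : 'I_n -> R).
Hypotheses (n0 : (0 < n)%N) (s0 : (0 < s)%N) (a1 : \sum_i a i ^+ 2 <= 1)
  (idem : forall x, kappa (kappa x) = kappa x)
  (no_single : forall x, exists2 y, y != x & kappa y = kappa x).

Definition linked (r r' : 'I_p) :=
  (r != r') && [exists t, exists t', kappa (r, t) == kappa (r', t')].

Lemma linked_sym r r' : linked r r' = linked r' r.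
Proof.
rewrite /linked eq_sym; congr (_ && _).
by apply/existsP/existsP => -[t /existsP[t' /eqP e]]; exists t'; apply/existsP;
  exists t; rewrite e.
Qed.

(** An independent set that is maximal for inclusion is dominating: a walk linked to none of its
    members could be added. *)
Lemma maximal_unlinked : exists A : {set 'I_p},
  (forall r r', r \in A -> r' \in A -> ~~ linked r r') /\
  (forall r, r \notin A -> exists2 r', r' \in A & linked r' r).
Proof.
pose ind (A : {set 'I_p}) := [forall r in A, forall r' in A, ~~ linked r r'].
have ind0 : ind finset.set0 by apply/forall_inP => r; rewrite inE.
have [A /maxsetP[indA maxA] _] := maxset_exists ind0.
have {}indA r r' : r \in A -> r' \in A -> ~~ linked r r'.
  by move=> hr; move: r'; apply/forall_inP; move: r hr; apply/forall_inP.
exists A; split=> // r rA; apply: contrapT => h.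
have hA r' : r' \in A -> ~~ linked r' r.
  by move=> hr'; apply/negP => l; apply: h; exists r'.
have /maxA : ind (r |: A)%SET.
  apply/forall_inP => r1; rewrite !inE => /predU1P[->|h1];
    apply/forall_inP => r2; rewrite !inE => /predU1P[->|h2].
  - by rewrite /linked eqxx.
  - by rewrite linked_sym hA.
  - by rewrite hA.
  - exact: indA.
by move=> /(_ (finset.subsetUr _ _)) e; move: rA; rewrite -e !inE eqxx.
Qed.

Lemma walk_rank_late (late : pred 'I_p) r r' : ~~ late r -> late r' ->
  (walk_rank late r < walk_rank late r')%N.
Proof.
rewrite /walk_rank => /negbTE-> ->; rewrite mul0n mul1n add0n.
by apply: leq_trans (ltn_ord r) _; apply: leq_addr.
Qed.

(* The walks of a maximal unlinked family [A] each repeat a step of some walk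
   outside [A], or one of their own, and conversely the other walks repeat steps
   of [A]: so the weights of [A] alone, or of its complement alone, suffice, and
   the general case follows by AM-GM. *)
Lemma sum_consistent_walks :
  \sum_(w | consistent w) \prod_r `|a (vertex w r 0)| <=
    n%:R ^+ #|[pred x | kappa x == x]|.
Proof.
have [A [indA maxA]] := maximal_unlinked.
pose c i := `|a i| ^+ 2.
have c0 i : 0 <= c i by rewrite exprn_ge0.
have c1 : \sum_i c i <= 1 by under eq_bigr do rewrite /c real_normK ?num_real//.
have h1 : \sum_(w | consistent w) \prod_(r in A) c (vertex w r 0) <=
    n%:R ^+ #|[pred x | kappa x == x]|.
  apply: (@sum_walks_late (fun r => r \notin A)) => // r rA.
  have [r' r'A /andP[_ /existsP[t' /existsP[t /eqP e]]]] := maxA _ rA.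
  exists t; apply/not_firstP; exists (r', t') => //.
  by rewrite /precedes walk_rank_late//= negbK.
have h2 : \sum_(w | consistent w) \prod_(r in ~: A) c (vertex w r 0) <=
    n%:R ^+ #|[pred x | kappa x == x]|.
  apply: (@sum_walks_late (fun r => r \in A)) => // r; rewrite !inE negbK => rA.
  have [[r' t'] ne e] := no_single (r, Ordinal s0).
  have [er|ner] := eqVneq r' r.
    rewrite er in ne e; exists t'; apply/not_firstP; exists (r, Ordinal s0) => //.
    rewrite /precedes /= eqxx ltnn /= lt0n; apply: contraNneq ne => t'0.
    by rewrite xpair_eqE eqxx /=; apply/eqP/val_inj.
  exists (Ordinal s0); apply/not_firstP; exists (r', t') => //.
  rewrite /precedes walk_rank_late//; apply/negP => r'A.
  have /negP := indA _ _ r'A rA; apply; rewrite /linked ner /=.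
  by apply/existsP; exists t'; apply/existsP; exists (Ordinal s0); rewrite e.
have : 2 * \sum_(w | consistent w) \prod_r `|a (vertex w r 0)| <=
    n%:R ^+ #|[pred x | kappa x == x]| + n%:R ^+ #|[pred x | kappa x == x]|.
  apply: le_trans (lerD h1 h2); rewrite -big_split mulr_sumr; apply: ler_sum => w _ /=.
  rewrite (bigID (fun r => r \in A)) /=.
  rewrite /c !prodrXl [X in _ <= _ + X ^+ 2](eq_bigl (fun r => r \notin A)); last first.
    by move=> r; rewrite inE.
  move: (\prod_(r in A) _) (\prod_(r | r \notin A) _) => x y.
  by have := sqr_ge0 (x - y); rewrite sqrrB; lra.
by lra.
Qed.

(** Each fixed point is sent to another step of its fibre. That step is not fixed, and [kappa]
    recovers the fixed point from it, so the map is injective. *)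
Lemma card_fixed_le : (2 * #|[pred x | kappa x == x]| <= p * s)%N.
Proof.
have ch x : exists y, (y != x) && (kappa y == kappa x).
  by have [y h /eqP e] := no_single x; exists y; rewrite h.
pose g x := xchoose (ch x).
have gP x : g x != x /\ kappa (g x) = kappa x.
  by have /andP[h /eqP] := xchooseP (ch x).
have -> : (p * s)%N = #|{: step}| by rewrite card_prod !card_ord.
rewrite -(cardC [pred x | kappa x == x]) mul2n -addnn leq_add2l.
rewrite -(@card_in_imset _ _ g [pred x | kappa x == x]); last first.
  move=> x y; rewrite !inE => /eqP hx /eqP hy e.
  by rewrite -hx -hy -(gP x).2 -(gP y).2 e.
apply: subset_leq_card; apply/fintype.subsetP => y /imsetP[x].
by rewrite !inE => /eqP hx ->; rewrite (gP x).2 hx eq_sym (gP x).1.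
Qed.

End Bound.
End WalkCounting.

(** * Sums over tuples of walks, grouped by pattern *)

Section MomentSum.
Variables (R : realFieldType) (n p s : nat).
Local Notation walks := {ffun 'I_p -> {ffun 'I_s.+1 -> 'I_n}}.
Local Notation step := ('I_p * 'I_s)%type.
Implicit Types (w : walks) (x y : step) (r : 'I_p).

(** The outcome of [pick] depends only on the predicate, so steps with the same edge get the same
    representative; the default [x] is never reached. *)
Definition leader w : {ffun step -> step} :=
  [ffun x => odflt x [pick y | edge w y == edge w x]].

Lemma edge_leader w x : edge w (leader w x) = edge w x.
Proof.
by rewrite ffunE; case: pickP => [y /eqP //|/(_ x)]; rewrite eqxx.
Qed.

Lemma eq_leader w x y : edge w x = edge w y -> leader w x = leader w y.
Proof.
move=> e; rewrite !ffunE e; case: pickP => // /(_ y).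
by rewrite eqxx.
Qed.

Lemma leader_idem w x : leader w (leader w x) = leader w x.
Proof. by apply: eq_leader; rewrite edge_leader. Qed.

Definition repeating w := [forall x, exists y, (y != x) && (edge w y == edge w x)].

Definition edge_count w := #|[pred x | leader w x == x]|.

(** A self-map is a free choice of image for each step: the step itself, of weight 1, or one of the
    [(p * s).-1] others, of weight [z]. Taking all self-maps rather than the idempotent ones gives
    this closed form. *)
Lemma sum_patterns (z : R) :
  \sum_(k : {ffun step -> step}) z ^+ #|[pred x | k x != x]| =
  (1 + (p * s).-1%:R * z) ^+ (p * s).
Proof.
transitivity (\sum_(k : {ffun step -> step}) \prod_x (if k x != x then z else 1)).
  by apply: eq_bigr => k _; rewrite -big_mkcond /= prodr_const.
rewrite -(bigA_distr_bigA (fun x y => if y != x then z else 1)) /=.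
transitivity (\prod_(x : step) (1 + (p * s).-1%:R * z)); last first.
  by rewrite prodr_const card_prod !card_ord.
apply: eq_bigr => x _; rewrite (bigD1 x) //= eqxx /=; congr (_ + _).
rewrite (eq_bigr (fun=> z)); last by move=> y ->.
rewrite (eq_bigl (mem (predC1 x))) //.
by rewrite sumr_const mulr_natl cardC1 card_prod !card_ord.
Qed.

(** The [e] distinct edges give [(L ^+ 2 * z) ^+ e] and the remaining factors
    [(L * z) ^+ (m - 2 * e)]. The total exponent of [z] is [m - e], the number of non-fixed steps
    weighted in [sum_patterns]. *)
Lemma pattern_weight_le (sigma B L z : R) (e m : nat) : (2 * e <= m)%N ->
  0 <= sigma -> 0 <= B -> 0 <= L -> 0 <= z ->
  sigma ^+ 2 * n%:R <= L ^+ 2 * z -> B <= L * z ->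
  sigma ^+ (2 * e) * B ^+ (m - 2 * e) * n%:R ^+ e <= L ^+ m * z ^+ (m - e).
Proof.
move=> em s0 B0 L0 z0 hs hB.
have -> : L ^+ m * z ^+ (m - e) = (L ^+ 2 * z) ^+ e * (L * z) ^+ (m - 2 * e).
  rewrite (exprMn e (L ^+ 2)) (exprMn (m - 2 * e) L) -exprM mulrACA -!exprD subnKC//; congr (_ * _ ^+ _).
  by lia.
rewrite mulrAC exprM -(exprMn e (sigma ^+ 2)).
apply: ler_pM.
- by rewrite exprn_ge0// mulr_ge0 ?sqr_ge0.
- by rewrite exprn_ge0.
- by rewrite lerXn2r// nnegrE ?mulr_ge0 ?sqr_ge0// exprn_ge0.
- by rewrite lerXn2r// nnegrE mulr_ge0.
Qed.

Lemma moment_sum_le (a u : 'I_n -> R) (Ew : walks -> R) (sigma B L z ups : R) :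
  (0 < n)%N -> (0 < s)%N -> \sum_i a i ^+ 2 <= 1 -> (forall i, `|u i| <= ups) ->
  0 <= sigma -> 0 <= B -> 0 <= L -> 0 <= z ->
  sigma ^+ 2 * n%:R <= L ^+ 2 * z -> B <= L * z ->
  (forall w, ~~ repeating w -> Ew w = 0) ->
  (forall w, repeating w ->
    `|Ew w| <= sigma ^+ (2 * edge_count w) * B ^+ (p * s - 2 * edge_count w)) ->
  \sum_w \prod_r (a (vertex w r 0) * u (vertex w r s)) * Ew w <=
    ups ^+ p * L ^+ (p * s) * (1 + (p * s).-1%:R * z) ^+ (p * s).
Proof.
move=> n0 s0 a1 hu sg0 B0 L0 z0 hs hB Ew0 hEw.
have ups0 : 0 <= ups by apply: le_trans (hu (Ordinal n0)).
rewrite (bigID repeating) /= [X in _ + X]big1 ?addr0; last first.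
  by move=> w /Ew0 ->; rewrite mulr0.
rewrite (partition_big leader xpredT) //= -sum_patterns mulr_sumr.
apply: ler_sum => k _.
(* A pattern realised by no repeating tuple contributes 0; a realised one inherits from [w0] that it
   is idempotent with no singleton fibre. *)
have [[w0 [w0r w0k]]|none] := pselect (exists w0, repeating w0 /\ leader w0 = k); last first.
  rewrite big1 ?mulr_ge0 ?exprn_ge0// => w /andP[wr /eqP wk].
  by case: none; exists w.
have idem x : k (k x) = k x by rewrite -w0k leader_idem.
have no_single x : exists2 y, y != x & k y = k x.
  have /forallP /(_ x) /existsP[y /andP[ne /eqP e]] := w0r.
  by exists y => //; rewrite -w0k; apply: eq_leader.
have em := card_fixed_le no_single.
set e := #|[pred x | k x == x]| in em.
have -> : #|[pred x | k x != x]| = (p * s - e)%N.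
  have := cardC [pred x | k x == x]; rewrite card_prod !card_ord -/e => <-.
  by rewrite addKn; apply: eq_card.
rewrite -[leRHS]mulrA.
apply: le_trans (_ : ups ^+ p * (sigma ^+ (2 * e) * B ^+ (p * s - 2 * e) * n%:R ^+ e) <= _);
  last by rewrite ler_wpM2l ?exprn_ge0// pattern_weight_le.
apply: le_trans (_ : ups ^+ p * (sigma ^+ (2 * e) * B ^+ (p * s - 2 * e) *
   \sum_(w | consistent k w) \prod_r `|a (vertex w r 0)|) <= _); last first.
  rewrite ler_wpM2l ?exprn_ge0// ler_wpM2l ?mulr_ge0 ?exprn_ge0//.
  exact: sum_consistent_walks.
rewrite mulrA mulr_sumr.
(* The tuples of pattern [k] are among the consistent ones, and the additional terms are
   non-negative. *)
rewrite [leRHS](bigID (fun w => repeating w && (leader w == k))) /=.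
rewrite ler_wpDr ?sumr_ge0//.
  by move=> w _; rewrite !mulr_ge0 ?exprn_ge0// prodr_ge0.
rewrite [leRHS](eq_bigl (fun w => repeating w && (leader w == k))); last first.
  move=> w; case: (repeating w); rewrite ?andbF//=; case: eqP => //=; rewrite ?andbF// andbT => <-.
  by apply/forallP => x; rewrite edge_leader.
apply: ler_sum => w /andP[wr /eqP wk].
apply: le_trans (ler_norm _) _; rewrite normrM normr_prod.
rewrite (eq_bigr (fun r => `|a (vertex w r 0)| * `|u (vertex w r s)|)); last first.
  by move=> r _; rewrite normrM.
rewrite big_split /= -[leLHS]mulrA [leRHS]mulrC ler_wpM2l ?prodr_ge0//; apply: ler_pM => //.
- by rewrite prodr_ge0.
- have -> : ups ^+ p = \prod_(r < p) ups by rewrite prodr_const card_ord.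
  apply: ler_prod => r _.
  by rewrite normr_ge0 hu.
- by have := hEw _ wr; rewrite /edge_count wk.
Qed.

End MomentSum.

(** * Means of bounded measurable functions *)

(** With truncated entries, every function whose mean is needed falls in this class, which is closed
    under the ring operations and integrable for a probability. *)
Definition bounded_mfun (d : measure_display) (T : measurableType d) (R : realType)
    (f : T -> R) : Prop :=
  measurable_fun setT f /\ exists M : R, forall x, `|f x| <= M.

Section BoundedMeasurable.
Variables (d : measure_display) (T : measurableType d) (R : realType).
Implicit Types (f g : T -> R) (A : set T).

Lemma bounded_mfun_cst c : bounded_mfun (fun _ : T => c : R).
Proof. by split; [exact: measurable_cst|exists `|c|]. Qed.

Lemma bounded_mfunD f g : bounded_mfun f -> bounded_mfun g ->
  bounded_mfun (fun x => f x + g x).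
Proof.
move=> [mf [a ha]] [mg [b hb]]; split; first exact: measurable_funD.
by exists (a + b) => x; apply: le_trans (ler_normD _ _) (lerD (ha x) (hb x)).
Qed.

Lemma bounded_mfunM f g : bounded_mfun f -> bounded_mfun g ->
  bounded_mfun (fun x => f x * g x).
Proof.
move=> [mf [a ha]] [mg [b hb]]; split; first exact: measurable_funM.
by exists (a * b) => x; rewrite normrM ler_pM.
Qed.

Lemma bounded_mfunB f g : bounded_mfun f -> bounded_mfun g ->
  bounded_mfun (fun x => f x - g x).
Proof.
move=> [mf [a ha]] [mg [b hb]]; split; first exact: measurable_funB.
by exists (a + b) => x; apply: le_trans (ler_normB _ _) (lerD (ha x) (hb x)).
Qed.

Lemma bounded_mfunX f k : bounded_mfun f -> bounded_mfun (fun x => f x ^+ k).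
Proof.
move=> [mf [a ha]]; split; first exact: measurable_funX.
exists (a ^+ k) => x; rewrite normrX lerXn2r// nnegrE//.
exact: le_trans (ha x).
Qed.

Lemma bounded_mfun_sum (I : Type) (r : seq I) (Q : pred I) (f : I -> T -> R) :
  (forall i, bounded_mfun (f i)) -> bounded_mfun (fun x => \sum_(i <- r | Q i) f i x).
Proof.
move=> hf; elim: r => [|i r IH].
  by under [fun _ => _]eq_fun do rewrite big_nil; exact: bounded_mfun_cst.
under [fun _ => _]eq_fun do rewrite big_cons.
by case: (Q i) => //; apply: bounded_mfunD.
Qed.

Lemma bounded_mfun_prod (I : Type) (r : seq I) (Q : pred I) (f : I -> T -> R) :
  (forall i, bounded_mfun (f i)) -> bounded_mfun (fun x => \prod_(i <- r | Q i) f i x).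
Proof.
move=> hf; elim: r => [|i r IH].
  by under [fun _ => _]eq_fun do rewrite big_nil; exact: bounded_mfun_cst.
under [fun _ => _]eq_fun do rewrite big_cons.
by case: (Q i) => //; apply: bounded_mfunM.
Qed.

Lemma bounded_mfun_indic A : measurable A -> bounded_mfun (\1_A : T -> R).
Proof.
move=> mA; split; first exact: measurable_indic.
by exists 1 => x; rewrite indicE; case: (_ \in _); rewrite ?normr1 ?normr0.
Qed.

Variable P : probability T R.

Definition mean f : R := \int[P]_x f x.

Lemma bounded_mfun_integrable f : bounded_mfun f -> P.-integrable setT (EFin \o f).
Proof.
move=> [mf [M hM]]; apply: measurable_bounded_integrable => //.
  by apply: le_lt_trans (probability_le1 P measurableT) _; rewrite ltry.
exists M; split; first exact: num_real.
by move=> N MN x _; apply: le_trans (hM x) (ltW MN).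
Qed.

Local Hint Resolve bounded_mfun_integrable : core.

Lemma mean_cst c : mean (fun=> c) = c.
Proof.
rewrite /mean Rintegral_cst// -[RHS]mulr1; congr (_ * _).
by rewrite -[RHS]/(fine 1%E); congr fine; exact: probability_setT.
Qed.

Lemma meanD f g : bounded_mfun f -> bounded_mfun g ->
  mean (fun x => f x + g x) = mean f + mean g.
Proof. by move=> hf hg; rewrite /mean RintegralD//; auto. Qed.

Lemma meanB f g : bounded_mfun f -> bounded_mfun g ->
  mean (fun x => f x - g x) = mean f - mean g.
Proof. by move=> hf hg; rewrite /mean RintegralB//; auto. Qed.

Lemma meanZ c f : bounded_mfun f -> mean (fun x => c * f x) = c * mean f.
Proof. by move=> hf; rewrite /mean RintegralZl//; auto. Qed.

Lemma mean_sum (I : Type) (r : seq I) (Q : pred I) (f : I -> T -> R) :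
  (forall i, bounded_mfun (f i)) ->
  mean (fun x => \sum_(i <- r | Q i) f i x) = \sum_(i <- r | Q i) mean (f i).
Proof.
move=> hf; elim: r => [|i r IH].
  by under [fun _ => _]eq_fun do rewrite big_nil; rewrite big_nil mean_cst.
under [fun _ => _]eq_fun do rewrite big_cons; rewrite big_cons -IH.
by case: (Q i) => //; rewrite meanD//; apply: bounded_mfun_sum.
Qed.

Lemma mean_le f g : bounded_mfun f -> bounded_mfun g -> (forall x, f x <= g x) ->
  mean f <= mean g.
Proof. by move=> hf hg fg; apply: le_Rintegral => //; auto. Qed.

Lemma mean_norm_le f c : bounded_mfun f -> (forall x, `|f x| <= c) -> `|mean f| <= c.
Proof.
move=> hf hc; have hf' := hf; rewrite ler_norml; apply/andP; split.
  rewrite -[leLHS]mean_cst; apply: mean_le => //; first exact: bounded_mfun_cst.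
  by move=> x; have := hc x; rewrite ler_norml => /andP[].
rewrite -[leRHS]mean_cst; apply: mean_le => //; first exact: bounded_mfun_cst.
by move=> x; have := hc x; rewrite ler_norml => /andP[].
Qed.

Lemma mean_indic A : measurable A -> mean (\1_A) = fine (P A).
Proof. by move=> mA; rewrite /mean /Rintegral integral_indic// setIT. Qed.

End BoundedMeasurable.

(** * Extension of identities from indicators to bounded functions *)

Section LayerCake.
Variables (d : measure_display) (T : measurableType d) (R : realType).
Variable P : probability T R.
Implicit Types (Z : T -> R).

(** The sum is [e] times the integer part of [y / e]. *)
Lemma layer_cake_approx (e y : R) (N : nat) : 0 < e -> 0 <= y -> y <= N%:R * e ->
  `|y - \sum_(k < N) (if k.+1%:R * e <= y then e else 0)| <= e.
Proof.
move=> e0 y0; elim: N => [|N IH] hy.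
  by rewrite big_ord0 subr0 ger0_norm//; apply: le_trans hy _; rewrite mul0r ltW.
rewrite big_ord_recr /=; have [yN|yN] := lerP y (N%:R * e).
  rewrite ifF ?addr0 ?IH//; apply/negbTE; rewrite -ltNge.
  by apply: le_lt_trans yN _; rewrite ltr_pM2r// ltr_nat.
rewrite (eq_bigr (fun=> e)); last first.
  move=> k _; rewrite ifT//.
  by apply: le_trans (ltW yN); rewrite ler_pM2r// ler_nat.
rewrite sumr_const card_ord -mulr_natl -natr1 in hy *.
by have [h|h] := lerP (_ * e) y; rewrite ler_norml; apply/andP; split; lra.
Qed.

Lemma eq0_le_inv_nat (D C : R) : (forall N : nat, (0 < N)%N -> `|D| <= C / N%:R) -> D = 0.
Proof.
move=> h; apply/eqP; rewrite -normr_eq0; apply/negPn/negP => D0.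
have Dp : 0 < `|D| by rewrite lt_def D0 normr_ge0.
have C0 : 0 <= C by have := h 1%N isT; rewrite divr1; apply: le_trans.
have := h (Num.bound (C / `|D|)).+1 isT; apply/negP; rewrite -ltNge.
rewrite ltr_pdivrMr ?ltr0n// mulrC -ltr_pdivrMr//.
apply: lt_trans (archi_boundP _) _; first by rewrite divr_ge0.
by rewrite ltr_nat.
Qed.

(** A bounded measurable function is a uniform limit of layer sums, to which the equality extends by
    linearity. For independence, [Z1] is the product of the other factors; for symmetry, [X2] is
    [- X1] and both weights are 1. *)
Lemma mean_transfer Z1 Z2 (X1 X2 : T -> R) (f : R -> R) :
  bounded_mfun Z1 -> bounded_mfun Z2 ->
  measurable_fun setT X1 -> measurable_fun setT X2 ->
  (forall A : set R, measurable A ->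
     mean P (fun w => Z1 w * \1_A (X1 w)) = mean P (fun w => Z2 w * \1_A (X2 w))) ->
  bounded_mfun f ->
  mean P (fun w => Z1 w * f (X1 w)) = mean P (fun w => Z2 w * f (X2 w)).
Proof.
move=> bZ1 bZ2 mX1 mX2 hA [mf [M0 hM0]].
have [M M_gt0 hM] : exists2 M : R, 0 < M & forall x, `|f x| <= M.
  exists (`|M0| + 1) => [|x]; first by rewrite ltr_wpDl.
  by apply: le_trans (hM0 x) _; apply: le_trans (ler_norm _) _; rewrite lerDl.
have [[_ [m1 hm1]] [_ [m2 hm2]]] := (bZ1, bZ2).
apply/eqP; rewrite -subr_eq0; apply/eqP.
apply: (@eq0_le_inv_nat _ ((m1 + m2) * (2 * M))) => N N0.
(* The values of [f + M] lie between 0 and [2 * M], a range cut into [N] layers of height [e]. *)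
pose e := 2 * M / N%:R; have N0' : 0 < N%:R :> R by rewrite ltr0n.
have e0 : 0 < e by rewrite divr_gt0// mulr_gt0.
pose A (k : nat) := f @^-1` `[k.+1%:R * e - M, +oo[%classic.
have mA k : measurable (A k).
  by rewrite /A -[X in measurable X]setTI; apply: mf.
pose phi x := \sum_(k < N) e * \1_(A k) x - M.
have approx x : `|f x - phi x| <= e.
  have fM0 : 0 <= f x + M by have := hM x; rewrite ler_norml => /andP[]; lra.
  have fMN : f x + M <= N%:R * e.
    rewrite /e mulrCA mulfV ?mulr1 ?gt_eqF//.
    by have := hM x; rewrite ler_norml => /andP[]; lra.
  have := layer_cake_approx e0 fM0 fMN; congr (`|_| <= _).
  rewrite /phi opprB addrA; congr (_ - _); apply: eq_bigr => k _.
  have -> : \1_(A k) x = (nat_of_bool (k.+1%:R * e <= f x + M)%R)%:R :> R.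
    rewrite indicE; congr ((nat_of_bool _)%:R); apply/idP/idP;
      by rewrite inE /A /= in_itv /= andbT lerBlDr.
  by case: ifP; rewrite ?mulr1 ?mulr0.
have bfX (X : T -> R) : measurable_fun setT X -> bounded_mfun (f \o X).
  by move=> mX; split; [exact: measurableT_comp|exists M => x; apply: hM].
have bindX (X : T -> R) k : measurable_fun setT X -> bounded_mfun (fun w => \1_(A k) (X w) : R).
  move=> mX; have [m h] := bounded_mfun_indic R (mA k).
  by split; [exact: measurableT_comp|case: h => c h; exists c].
have bphiX (X : T -> R) : measurable_fun setT X -> bounded_mfun (phi \o X).
  move=> mX; apply: bounded_mfunB; last exact: bounded_mfun_cst.
  apply: bounded_mfun_sum => k; apply: bounded_mfunM; first exact: bounded_mfun_cst.
  exact: bindX.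
have phiE : mean P (fun w => Z1 w * phi (X1 w)) = mean P (fun w => Z2 w * phi (X2 w)).
  (* The constant [- M] is carried by the indicator of the whole line, so that [hA] covers it
     too. *)
  have sumE Z (X : T -> R) : bounded_mfun Z -> measurable_fun setT X ->
      mean P (fun w => Z w * phi (X w)) =
      \sum_(k < N) e * mean P (fun w => Z w * \1_(A k) (X w)) -
        M * mean P (fun w => Z w * \1_setT (X w)).
    move=> bZ mX.
    have bT : bounded_mfun (fun w => Z w * \1_[set: R] (X w)).
      by under [fun _ => _]eq_fun do rewrite indicT mulr1.
    have bk k : bounded_mfun (fun w => Z w * \1_(A k) (X w)).
      by apply: bounded_mfunM => //; apply: bindX.
    have bck c g : bounded_mfun g -> bounded_mfun (fun w : T => c * g w).
      by move=> bg; apply: bounded_mfunM => //; apply: bounded_mfun_cst.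
    transitivity (mean P (fun w => \sum_(k < N) e * (Z w * \1_(A k) (X w)) -
        M * (Z w * \1_[set: R] (X w)))).
      congr mean; apply/funext => w; rewrite /phi mulrBr mulr_sumr indicT mulr1.
      congr (_ - _); last by rewrite mulrC.
      by apply: eq_bigr => k _; rewrite mulrCA.
    rewrite (meanB _ (f := fun w => \sum_(k < N) e * (Z w * \1_(A k) (X w))));
      [|by apply: bounded_mfun_sum => k; apply: bck|exact: bck].
    rewrite meanZ// mean_sum; last by move=> k; apply: bck.
    by congr (_ - _); apply: eq_bigr => k _; rewrite meanZ.
  rewrite !sumE// hA//; congr (_ - _).
  by apply: eq_bigr => k _; rewrite hA.
have close Z (X : T -> R) m : bounded_mfun Z -> measurable_fun setT X ->
    (forall x, `|Z x| <= m) ->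
    `|mean P (fun w => Z w * f (X w)) - mean P (fun w => Z w * phi (X w))| <= m * e.
  move=> bZ mX hm.
  have b1 := bounded_mfunM bZ (bfX _ mX); have b2 := bounded_mfunM bZ (bphiX _ mX).
  rewrite -(meanB _ b1 b2); apply: mean_norm_le; first exact: bounded_mfunB.
  by move=> w; rewrite -mulrBr normrM ler_pM //=.
have h1 := close _ _ _ bZ1 mX1 hm1; have h2 := close _ _ _ bZ2 mX2 hm2.
rewrite phiE in h1; rewrite distrC in h2.
rewrite -(subrKA (mean P (fun w => Z2 w * phi (X2 w)))).
apply: le_trans (ler_normD _ _) _; apply: le_trans (lerD h1 h2) _.
by rewrite -mulrDl -[leRHS]mulrA.
Qed.
End LayerCake.

(** * Means of products of independent variables *)

Section Independence.
Variables (R : realType) (d : measure_display) (T : measurableType d)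
  (P : probability T R) (I : finType) (X : I -> {RV P >-> R}).

Lemma bounded_mfun_comp (f : R -> R) (Y : {RV P >-> R}) :
  bounded_mfun f -> bounded_mfun (fun w => f (Y w)).
Proof.
move=> [mf [M hM]]; split; first exact: measurableT_comp.
by exists M => x; apply: hM.
Qed.

Hypothesis indep : mutually_independent X.

Lemma mean_prod_indic (A : I -> set R) : (forall i, measurable (A i)) ->
  mean P (fun w => \prod_i \1_(A i) (X i w)) =
  \prod_i mean P (fun w => \1_(A i) (X i w)).
Proof.
move=> mA; have mXA i : measurable (X i @^-1` A i).
  by rewrite -[Y in measurable Y]setTI; apply: measurable_funPT.
have factor i : mean P (fun w => \1_(A i) (X i w)) = fine (P (X i @^-1` A i)).
  by rewrite -mean_indic//; congr mean; apply/funext => w; rewrite !indicE preimageE !inE.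
rewrite (eq_bigr _ (fun i _ => factor i)).
have -> : (fun w => \prod_i \1_(A i) (X i w) : R) =
    \1_(\bigcap_(i in [set` [set: I]%SET]) (X i @^-1` A i)).
  apply/funext => w; rewrite [RHS]indicE.
  have [h|h] := pselect (forall i, A i (X i w)).
    rewrite big1; last by move=> i _; rewrite indicE mem_set.
    by rewrite mem_set// => i _; apply: h.
  rewrite memNset; last by move=> h'; apply: h => i; apply: h' => /=; rewrite inE.
  move: h => /existsNP[i hi]; rewrite (bigD1 i)//= indicE memNset// mul0r.
  by [].
rewrite mean_indic; last by apply: fin_bigcap_measurable => //; exact: finite_finset.
rewrite indep//.
have -> : (\prod_(i in [set: I]%SET) P (X i @^-1` A i) =
    (\prod_(i in [set: I]%SET) fine (P (X i @^-1` A i)))%:E)%E.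
  elim/big_ind2: _ => [//|x y a b -> ->|i _]; first by rewrite EFinM.
  by rewrite fineK// fin_num_measure.
by rewrite /=; apply: eq_bigl => i; rewrite inE.
Qed.

(** Indicators are replaced by general functions one index at a time: outside [l] every function is
    an indicator, and [mean_transfer] treats the head of [l] with the product of the other factors
    as weight. *)
Lemma mean_prod_independent (g : I -> R -> R) : (forall i, bounded_mfun (g i)) ->
  mean P (fun w => \prod_i g i (X i w)) = \prod_i mean P (fun w => g i (X i w)).
Proof.
move=> bg.
suff h (l : seq I) (f : I -> R -> R) : (forall i, bounded_mfun (f i)) ->
    (forall i, i \notin l -> exists2 A, measurable A & f i = \1_A) ->
    mean P (fun w => \prod_i f i (X i w)) = \prod_i mean P (fun w => f i (X i w)).
  by apply: (h (enum I)) => // i; rewrite mem_enum.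
elim: l f => [|k l IH] f bf hf.
  have /choice[A hA] : forall i, exists A : set R, measurable A /\ f i = \1_A.
    by move=> i; have [A] := hf i isT; exists A.
  have -> : f = fun i => \1_(A i) by apply/funext => i; case: (hA i).
  by apply: mean_prod_indic => i; case: (hA i).
pose Z w := \prod_(i | i != k) f i (X i w).
pose c := \prod_(i | i != k) mean P (fun w => f i (X i w)).
have bZ : bounded_mfun Z by apply: bounded_mfun_prod => i; apply: bounded_mfun_comp.
have -> : (fun w => \prod_i f i (X i w)) = (fun w => Z w * f k (X k w)).
  by apply/funext => w; rewrite (bigD1 k)//= mulrC.
rewrite (bigD1 k)//= mulrC -/c -meanZ; last exact: bounded_mfun_comp.
apply: (@mean_transfer _ _ _ P Z (fun=> c)) => //; first exact: bounded_mfun_cst.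
move=> A mA; have b1 := bounded_mfun_indic R mA.
pose fA i := if i == k then \1_A else f i.
have := IH fA; rewrite (bigD1 k)//= /fA eqxx => IH'.
rewrite meanZ; last exact: bounded_mfun_comp.
transitivity (mean P (fun w => \prod_i fA i (X i w))).
  congr mean; apply/funext => w; rewrite (bigD1 k)//= /fA eqxx mulrC; congr (_ * _).
  by apply: eq_bigr => i /negbTE ->.
rewrite IH' => [|i|i il].
- rewrite mulrC; congr (_ * _); apply: eq_bigr => i /negbTE ik.
  by rewrite ik.
- by case: ifP.
- case: ifPn => [_|ik]; first by exists A.
  by apply: hf; rewrite inE negb_or ik.
Qed.

End Independence.

(** * Truncated entries *)

Section Truncation.
Variables (R : realType) (B : R).
Hypothesis B0 : 0 <= B.
Implicit Types x : R.

Definition trunc x : R := x * \1_(`[- B, B]%classic) x.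

Lemma trunc_id x : `|x| <= B -> trunc x = x.
Proof.
move=> xB; rewrite /trunc indicE mem_set ?mulr1//= in_itv /=.
by rewrite -ler_norml.
Qed.

Lemma trunc_eq0 x : B < `|x| -> trunc x = 0.
Proof.
move=> xB; rewrite /trunc indicE memNset ?mulr0//= in_itv /=.
by rewrite -ler_norml; apply/negP; rewrite -ltNge.
Qed.

Lemma trunc_norm_le x : `|trunc x| <= B.
Proof.
have [xB|xB] := lerP `|x| B; first by rewrite trunc_id.
by rewrite trunc_eq0// normr0.
Qed.

Lemma truncN x : trunc (- x) = - trunc x.
Proof.
have [xB|xB] := lerP `|x| B; first by rewrite !trunc_id// normrN.
by rewrite !trunc_eq0// ?normrN// oppr0.
Qed.

Lemma trunc_sqr_le x : trunc x ^+ 2 <= x ^+ 2.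
Proof.
have [xB|xB] := lerP `|x| B; first by rewrite trunc_id.
by rewrite trunc_eq0// expr0n sqr_ge0.
Qed.

Lemma bounded_mfun_trunc : bounded_mfun trunc.
Proof.
split; last by exists B; apply: trunc_norm_le.
by apply: measurable_funM => //; apply: measurable_indic.
Qed.

Lemma normr_trunc_exp_le x k : (2 <= k)%N ->
  `|trunc x ^+ k| <= B ^+ (k - 2) * trunc x ^+ 2.
Proof.
move=> k2; rewrite -{1}(subnK k2) exprD normrM (ger0_norm (sqr_ge0 _)).
rewrite ler_wpM2r ?sqr_ge0// normrX lerXn2r// trunc_norm_le//.
Qed.

Variables (d : measure_display) (T : measurableType d) (P : probability T R)
  (H : {RV P >-> R}).

Lemma bounded_mfun_truncRV : bounded_mfun (fun w => trunc (H w)).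
Proof. exact: bounded_mfun_comp bounded_mfun_trunc. Qed.

(** The mean being zero, the variance is the second moment, which truncation only lowers. *)
Lemma mean_trunc_sqr_le (v : R) : ('E_P[H] = 0)%E -> ('V_P[H] <= v%:E)%E ->
  mean P (fun w => trunc (H w) ^+ 2) <= v.
Proof.
move=> EH; rewrite /variance covariance.unlock EH /= => Vv.
have bt := bounded_mfunX 2 bounded_mfun_truncRV.
rewrite -lee_fin; apply: le_trans Vv; rewrite /mean /Rintegral fineK; last first.
  exact/integrable_fin_num/bounded_mfun_integrable.
rewrite unlock; apply: ge0_le_integral => //.
- by move=> w _; rewrite lee_fin sqr_ge0.
- by apply/measurable_EFinP; case: bt.
- apply/measurable_EFinP; apply: measurable_funM; apply: measurable_funB => //.
- move=> w _; rewrite lee_fin; apply: le_trans (trunc_sqr_le _) _.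
  by rewrite -[leRHS]/((H w - 0) * (H w - 0)) subr0 expr2.
Qed.

Lemma mean_trunc_bounded : ('E_P[H] = 0)%E ->
  {ae P, forall w, `|H w| <= B} -> mean P (fun w => trunc (H w)) = 0.
Proof.
move=> EH ae; rewrite /mean /Rintegral -[RHS]/(fine 0%E) -EH unlock; congr fine.
apply: ae_eq_integral => //.
- by apply/measurable_EFinP; case: bounded_mfun_truncRV.
- by apply/measurable_EFinP.
- by apply: filterS ae => w hw _; rewrite trunc_id.
Qed.

(** [trunc] is odd and [H] has the law of [- H], so the mean is its own opposite. *)
Lemma mean_trunc_symmetric : symmetric_distribution H ->
  mean P (fun w => trunc (H w)) = 0.
Proof.
move=> sym.
have E : mean P (fun w => 1 * trunc (H w)) = mean P (fun w => 1 * trunc (- H w)).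
  apply: (mean_transfer (X2 := fun w => - H w)).
  - exact: bounded_mfun_cst.
  - exact: bounded_mfun_cst.
  - by [].
  - exact: measurableT_comp.
  - move=> A mA.
    have mAH : measurable [set w | A (H w)].
      by rewrite -[Y in measurable Y]setTI; apply: measurable_funPT.
    have mAN : measurable [set w | A (- H w)].
      rewrite -[Y in measurable Y]setTI.
      by apply: (measurableT_comp (@oppr_measurable R setT) (measurable_funPT H)).
    have := sym A mA; move=> /(congr1 fine); rewrite -!mean_indic//.
    by congr (_ = _); congr mean; apply/funext => w; rewrite mul1r !indicE; congr (nat_of_bool _)%:R;
      apply/idP/idP; rewrite !inE.
  - exact: bounded_mfun_trunc.
have {E} : mean P (fun w => trunc (H w)) = - mean P (fun w => trunc (H w)).
  rewrite -[RHS]mulN1r -meanZ; last exact: bounded_mfun_truncRV.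
  transitivity (mean P (fun w => 1 * trunc (H w))).
    by congr mean; apply/funext => w; rewrite mul1r.
  by rewrite E; congr mean; apply/funext => w; rewrite truncN mul1r mulN1r.
lra.
Qed.

Lemma mean_trunc_exp_le (v : R) k : (2 <= k)%N ->
  mean P (fun w => trunc (H w) ^+ 2) <= v ->
  `|mean P (fun w => trunc (H w) ^+ k)| <= v * B ^+ (k - 2).
Proof.
move=> k2 hv; have b := bounded_mfun_truncRV.
have h w : - (B ^+ (k - 2) * trunc (H w) ^+ 2) <= trunc (H w) ^+ k <=
    B ^+ (k - 2) * trunc (H w) ^+ 2.
  by rewrite -ler_norml normr_trunc_exp_le.
have bk := bounded_mfunX k b; have b2 := bounded_mfunX 2 b.
have bB c : bounded_mfun (fun w => c * trunc (H w) ^+ 2).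
  by apply: bounded_mfunM => //; apply: bounded_mfun_cst.
apply: le_trans (_ : B ^+ (k - 2) * mean P (fun w => trunc (H w) ^+ 2) <= _); last first.
  by rewrite mulrC ler_wpM2r// exprn_ge0.
rewrite ler_norml; apply/andP; split.
  rewrite -mulNr -meanZ//; apply: mean_le => // w; rewrite mulNr.
  by case/andP: (h w).
by rewrite -meanZ//; apply: mean_le => // w; case/andP: (h w).
Qed.

End Truncation.

(** * Moments of powers of the truncated matrix *)

Section WalkExpansion.
Variables (R : comPzRingType) (n : nat).
Implicit Types (A : 'M[R]_n) (a u : 'cV[R]_n).

Definition extend_walk s (y : 'I_n * {ffun 'I_s.+1 -> 'I_n}) : {ffun 'I_s.+2 -> 'I_n} :=
  [ffun t => oapp y.2 y.1 (unlift ord0 t)].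

Lemma extend_walk_bij s : bijective (@extend_walk s).
Proof.
exists (fun f : {ffun 'I_s.+2 -> 'I_n} => (f ord0, [ffun t => f (lift ord0 t)])).
  move=> [i f]; rewrite /extend_walk ffunE unlift_none; congr (_, _).
  by apply/ffunP => t; rewrite !ffunE liftK.
move=> f; apply/ffunP => t; rewrite ffunE /=.
by case: unliftP => [t' ->|->] /=; rewrite ?ffunE.
Qed.

Lemma extend_walk0 s (y : 'I_n * {ffun 'I_s.+1 -> 'I_n}) : extend_walk y (inord 0) = y.1.
Proof.
rewrite ffunE (_ : inord 0 = ord0) ?unlift_none//.
by apply/val_inj; rewrite /= inordK.
Qed.

Lemma extend_walkS s (y : 'I_n * {ffun 'I_s.+1 -> 'I_n}) t : (t <= s)%N ->
  extend_walk y (inord t.+1) = y.2 (inord t).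
Proof.
move=> ts; rewrite ffunE (_ : inord t.+1 = lift ord0 (inord t)) ?liftK//.
by apply/val_inj; rewrite /= /bump /= !inordK.
Qed.

Lemma mulmx_walks A a u s : (a^T *m A ^+ s *m u) 0 0 =
  \sum_(f : {ffun 'I_s.+1 -> 'I_n})
    (a (f (inord 0)) 0 * u (f (inord s)) 0 * \prod_(t < s) A (f (inord t)) (f (inord t.+1))).
Proof.
elim: s a => [|s IH] a.
  rewrite mulmx1 mxE.
  rewrite (reindex (fun i : 'I_n => [ffun _ : 'I_1 => i])) /=; last first.
    exists (fun f : {ffun 'I_1 -> 'I_n} => f ord0) => [i _|f _]; first by rewrite ffunE.
    by apply/ffunP => t; rewrite ffunE (ord1 t).
  by apply: eq_bigr => i _; rewrite big_ord0 mulr1 !ffunE mxE.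
(* The first step is absorbed into the weight [a], which is why the induction keeps [a] general. *)
have -> : a^T *m A ^+ s.+1 = (A^T *m a)^T *m A ^+ s.
  by rewrite trmx_mul trmxK exprS mulmxA.
rewrite IH (reindex (@extend_walk s)) /=; last exact/onW_bij/extend_walk_bij.
rewrite -(pair_bigA _ (fun i f => a (extend_walk (i, f) (inord 0)) 0 *
  u (extend_walk (i, f) (inord s.+1)) 0 *
  \prod_(t < s.+1) A (extend_walk (i, f) (inord t)) (extend_walk (i, f) (inord t.+1)))) /=.
rewrite exchange_big; apply: eq_bigr => f _ /=.
rewrite mxE -mulrA mulr_suml; apply: eq_bigr => i _.
rewrite extend_walk0 extend_walkS// big_ord_recl /= extend_walk0 extend_walkS//= mxE.
rewrite [A _ _ * a _ _]mulrC -!mulrA; congr (_ * _); rewrite mulrCA; congr (_ * (_ * _)).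
apply: eq_bigr => t _; rewrite /bump /= !add1n !extend_walkS//.
exact: ltnW.
Qed.

Lemma mulmx_walksX A a u s p : (a^T *m A ^+ s *m u) 0 0 ^+ p =
  \sum_(w : {ffun 'I_p -> {ffun 'I_s.+1 -> 'I_n}})
    \prod_r (a (vertex w r 0) 0 * u (vertex w r s) 0) *
    \prod_(x : 'I_p * 'I_s) A (edge w x).1 (edge w x).2.
Proof.
rewrite mulmx_walks -[p in LHS]card_ord -prodr_const.
rewrite (bigA_distr_bigA (fun (_ : 'I_p) (f : {ffun 'I_s.+1 -> 'I_n}) =>
  a (f (inord 0)) 0 * u (f (inord s)) 0 * \prod_(t < s) A (f (inord t)) (f (inord t.+1)))) /=.
apply: eq_bigr => w _; rewrite big_split /=; congr (_ * _).
by rewrite pair_bigA.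
Qed.

End WalkExpansion.

(** * Mean of the product of entries along a tuple of walks *)

Section WalkMoments.
Variables (R : realType) (d : measure_display) (T : measurableType d)
  (P : probability T R) (n : nat) (H : 'I_n -> 'I_n -> {RV P >-> R}) (sigma B : R).
Hypotheses (B0 : 0 <= B) (sigma0 : 0 <= sigma)
  (indep : mutually_independent (fun ij : 'I_n * 'I_n => H ij.1 ij.2))
  (mean0 : forall i j, mean P (fun w => trunc B (H i j w)) = 0)
  (mean2 : forall i j, mean P (fun w => trunc B (H i j w) ^+ 2) <= sigma ^+ 2).

Definition trunc_mx (w : T) : 'M[R]_n := \matrix_(i, j) trunc B (H i j w).

Section Fixed.
Variables (p s : nat) (k : {ffun 'I_p -> {ffun 'I_s.+1 -> 'I_n}}).

Definition mult (e : 'I_n * 'I_n) := #|[pred x | edge k x == e]|.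

Lemma sum_mult : (\sum_e mult e = p * s)%N.
Proof.
transitivity (\sum_(x : 'I_p * 'I_s) 1)%N.
  by rewrite (partition_big (edge k) xpredT)//=; apply: eq_bigr => e _; rewrite sum1_card.
by rewrite sum1_card card_prod !card_ord.
Qed.

Lemma mult_repeating e : repeating k -> mult e != 0%N -> (2 <= mult e)%N.
Proof.
move=> /forallP rep; rewrite -lt0n => /card_gt0P[x]; rewrite inE => /eqP xe.
have /existsP[y /andP[ne /eqP ye]] := rep x.
rewrite /mult (cardD1 x) (cardD1 y) !inE xe eqxx ye xe eqxx ne.
by [].
Qed.

Lemma card_mult : #|[pred e | mult e != 0%N]| = edge_count k.
Proof.
rewrite /edge_count -(@card_in_imset _ _ (edge k) [pred x | leader k x == x]).
  apply: eq_card => e; rewrite !inE -lt0n; apply/card_gt0P/imsetP => -[x].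
    rewrite inE => /eqP xe; exists (leader k x); rewrite ?edge_leader//.
    by rewrite inE leader_idem.
  by move=> _ ->; exists x; rewrite inE.
by move=> x y; rewrite !inE => /eqP hx /eqP hy e; rewrite -hx -hy; apply: eq_leader.
Qed.

Definition walk_mean := mean P (fun w =>
  \prod_(x : 'I_p * 'I_s) trunc_mx w (edge k x).1 (edge k x).2).

(** Factors are grouped by ordered pair, [H i j] and [H j i] being different variables, and
    independence splits the mean. *)
Lemma walk_meanE : walk_mean =
  \prod_(e : 'I_n * 'I_n) mean P (fun w => trunc B (H e.1 e.2 w) ^+ mult e).
Proof.
rewrite -(mean_prod_independent indep (g := fun e x => trunc B x ^+ mult e)); last first.
  by move=> e; apply: bounded_mfunX; apply: bounded_mfun_trunc.
congr mean; apply/funext => w.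
rewrite (partition_big (edge k) xpredT)//=; apply: eq_bigr => e _.
rewrite -prodr_const; apply: eq_big => x; first by rewrite inE.
by move=> /eqP <-; rewrite mxE.
Qed.

(** An edge used exactly once contributes the mean of one truncated entry, which is 0. *)
Lemma walk_mean_eq0 : ~~ repeating k -> walk_mean = 0.
Proof.
rewrite negb_forall => /existsP[x /existsPn hx].
rewrite walk_meanE (bigD1 (edge k x)) //= (_ : mult _ = 1%N) ?mean0 ?mul0r//.
rewrite /mult (cardD1 x) !inE eqxx eq_card0 // => y; rewrite !inE.
by have := hx y; rewrite negb_and negbK => /orP[->//|/negbTE ->]; rewrite andbF.
Qed.

(** An edge of multiplicity [m >= 2] contributes at most [sigma ^+ 2 * B ^+ (m - 2)] and an absent
    edge contributes 1; the multiplicities add up to [p * s]. *)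
Lemma walk_mean_le : repeating k ->
  `|walk_mean| <= sigma ^+ (2 * edge_count k) * B ^+ (p * s - 2 * edge_count k).
Proof.
move=> rep; rewrite walk_meanE normr_prod (bigID (fun e => mult e != 0%N)) /=.
rewrite [X in _ * X]big1 ?mulr1; last first.
  move=> e; rewrite negbK => /eqP ->.
  by under [fun _ => _]eq_fun do rewrite expr0; rewrite mean_cst normr1.
apply: (@le_trans _ _ (\prod_(e | mult e != 0%N) (sigma ^+ 2 * B ^+ (mult e - 2)))).
  apply: ler_prod => e he; rewrite normr_ge0 /=.
  by apply: mean_trunc_exp_le => //; apply: mult_repeating.
rewrite big_split /= prodr_const -exprM prodrXr card_mult.
rewrite (_ : (\sum_(e | mult e != 0%N) (mult e - 2) = p * s - 2 * edge_count k)%N)//.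
rewrite -sum_mult [in RHS](bigID (fun e => mult e != 0%N)) /=.
rewrite [X in (_ + X - _)%N]big1 ?addn0; last by move=> e; rewrite negbK => /eqP.
rewrite -card_mult -sum1_card big_distrr /= -sumnB//.
by move=> e he; rewrite mult_repeating.
Qed.

End Fixed.

Lemma bounded_mfun_trunc_mx s (a u : 'cV[R]_n) :
  bounded_mfun (fun w => (a^T *m trunc_mx w ^+ s *m u) 0 0).
Proof.
under [fun _ => _]eq_fun do rewrite mulmx_walks.
apply: bounded_mfun_sum => f; apply: bounded_mfunM; first exact: bounded_mfun_cst.
apply: bounded_mfun_prod => t; under [fun _ => _]eq_fun do rewrite mxE.
exact: bounded_mfun_truncRV.
Qed.

Lemma mean_moment_le (a u : 'cV[R]_n) (L z ups : R) (p s : nat) :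
  (0 < n)%N -> (0 < s)%N -> \sum_i a i 0 ^+ 2 <= 1 -> (forall i, `|u i 0| <= ups) ->
  0 <= L -> 0 <= z -> sigma ^+ 2 * n%:R <= L ^+ 2 * z -> B <= L * z ->
  mean P (fun w => (a^T *m trunc_mx w ^+ s *m u) 0 0 ^+ p) <=
    ups ^+ p * L ^+ (p * s) * (1 + (p * s).-1%:R * z) ^+ (p * s).
Proof.
move=> n0 s0 a1 hu L0 z0 hs hB.
have bw k : bounded_mfun (fun w => \prod_(x : 'I_p * 'I_s)
    trunc_mx w (@edge n p s k x).1 (edge k x).2).
  apply: bounded_mfun_prod => x; under [fun _ => _]eq_fun do rewrite mxE.
  exact: bounded_mfun_truncRV.
under [fun _ => _]eq_fun do rewrite mulmx_walksX.
rewrite mean_sum; last by move=> k; apply: bounded_mfunM; [exact: bounded_mfun_cst|exact: bw].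
under eq_bigr do rewrite meanZ//.
apply: (moment_sum_le (a := fun i => a i 0) (u := fun i => u i 0)
  (Ew := @walk_mean p s) n0 s0 a1 hu sigma0 B0 L0 z0 hs hB).
- exact: walk_mean_eq0.
- exact: walk_mean_le.
Qed.

End WalkMoments.

(** * Tail bounds *)

Section ProbabilityBounds.
Variables (R : realType) (d : measure_display) (T : measurableType d)
  (P : probability T R).

Lemma measurable_norm_ge (f : T -> R) t : measurable_fun setT f ->
  measurable [set w | t <= `|f w|].
Proof.
move=> mf; rewrite (_ : mkset _ = (@Num.norm R R \o f) @^-1` `[t, +oo[%classic); last first.
  by apply/seteqP; split => w /=; rewrite in_itv /= andbT.
by rewrite -[X in measurable X]setTI; apply: measurableT_comp.
Qed.

Lemma markov_even (f : T -> R) (t c : R) p : bounded_mfun f -> 0 < t ->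
  mean P (fun w => f w ^+ (2 * p)) <= c * t ^+ (2 * p) ->
  (P [set w | (t <= `|f w|)%R] <= c%:E)%E.
Proof.
move=> bf t0 hc; set A := mkset _.
have mA : measurable A by apply: measurable_norm_ge; case: bf.
have tp : 0 < t ^+ (2 * p) by rewrite exprn_gt0.
rewrite -[leLHS]fineK; last exact: fin_num_measure.
rewrite lee_fin -(ler_pM2r tp); apply: le_trans hc.
rewrite -mean_indic// mulrC -meanZ; last exact: bounded_mfun_indic.
apply: mean_le; [|exact: bounded_mfunX|move=> w].
  by apply: bounded_mfunM; [exact: bounded_mfun_cst|exact: bounded_mfun_indic].
have f0 : 0 <= f w ^+ (2 * p) by rewrite exprM exprn_ge0// sqr_ge0.
rewrite indicE; have [h|h] := pselect (A w); last by rewrite memNset// mulr0.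
rewrite mem_set// mulr1 -[leRHS]ger0_norm// normrX lerXn2r// nnegrE.
exact: ltW.
Qed.

Lemma union_bound (I : finType) (A : I -> set T) (c : R) :
  (forall i, measurable (A i)) -> (forall i, (P (A i) <= c%:E)%E) ->
  exists E, [/\ measurable E, forall i, A i `<=` E & (P E <= (#|I|%:R * c)%:E)%E].
Proof.
move=> mA hA.
suff h (s : seq I) : exists E, [/\ measurable E, forall i, i \in s -> A i `<=` E &
    (P E <= ((size s)%:R * c)%:E)%E].
  have [E [mE sE PE]] := h (enum I); exists E; split => // [i|].
    by apply: sE; rewrite mem_enum.
  by rewrite cardE.
elim: s => [|i s [E [mE sE PE]]].
  by exists set0; split; rewrite ?measure0 ?mul0r.
exists (A i `|` E); split.
- exact: measurableU.
- move=> j; rewrite inE => /predU1P[->|/sE h]; first exact: subsetUl.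
  by apply: subset_trans h _; apply: subsetUr.
- apply: le_trans (measureU2 _ _ _) _ => //=.
  by rewrite -natr1 mulrDl mul1r addrC EFinD leeD.
Qed.

End ProbabilityBounds.

(** * Tails of bilinear forms in powers of the truncated matrix *)

Section Tails.
Variables (R : realType) (d : measure_display) (T : measurableType d)
  (P : probability T R) (n : nat) (H : 'I_n -> 'I_n -> {RV P >-> R})
  (sigma B L : R) (k : nat).
Hypotheses (B0 : 0 <= B) (sigma0 : 0 <= sigma) (L0 : 0 < L)
  (indep : mutually_independent (fun ij : 'I_n * 'I_n => H ij.1 ij.2))
  (mean0 : forall i j, mean P (fun w => trunc B (H i j w)) = 0)
  (mean2 : forall i j, mean P (fun w => trunc B (H i j w) ^+ 2) <= sigma ^+ 2)
  (n1 : 1 <= ln (n%:R : R)) (kl : ln (n%:R : R) <= k%:R) (kl2 : k%:R <= 2 * ln (n%:R : R))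
  (sigmaL : sigma ^+ 2 * (n%:R * ln n%:R) <= L ^+ 2) (BL : B * ln n%:R <= L).

Let n0 : (0 < n)%N.
Proof.
by rewrite lt0n; apply/negP => /eqP n0; move: n1; rewrite n0 ln0// ler10.
Qed.

Let ln0 : 0 < ln (n%:R : R). Proof. exact: lt_le_trans n1. Qed.

(** Here [z = 1 / ln n]. From [p * s <= 4 * k] and [k <= 2 * ln n], the pattern sum costs at most a
    factor [1 + 8 = 9] per step. *)
Lemma mean_moment_le9 (a u : 'cV[R]_n) (ups : R) (p s : nat) :
  (0 < s)%N -> \sum_i a i 0 ^+ 2 <= 1 -> (forall i, `|u i 0| <= ups) ->
  (p * s <= 4 * k)%N ->
  mean P (fun w => (a^T *m trunc_mx H B w ^+ s *m u) 0 0 ^+ p) <=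
    ups ^+ p * (9 * L) ^+ (p * s).
Proof.
move=> s0 a1 hu psk.
have ups0 : 0 <= ups by apply: le_trans (hu (Ordinal n0)).
apply: le_trans (mean_moment_le B0 sigma0 indep mean0 mean2 p n0 s0 a1 hu (ltW L0)
  (z := (ln n%:R)^-1) _ _ _) _.
- by rewrite invr_ge0 ltW.
- by rewrite ler_pdivlMr// -mulrA.
- by rewrite ler_pdivlMr.
rewrite [X in _ <= _ * X]exprMn -mulrA ler_wpM2l ?exprn_ge0// mulrC.
rewrite ler_wpM2r ?exprn_ge0 ?(ltW L0)// lerXn2r ?nnegrE//.
  by rewrite addr_ge0// mulr_ge0 ?invr_ge0 ?(ltW ln0).
have h : (p * s).-1%:R <= 4 * k%:R :> R.
  by rewrite -natrM ler_nat; apply: leq_trans (leq_pred _) psk.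
have : (p * s).-1%:R / ln n%:R <= 8 :> R.
  rewrite ler_pdivrMr//; apply: (le_trans h); apply: (le_trans (ler_wpM2l (ler0n R 4) kl2)).
  by rewrite mulrA -natrM.
lra.
Qed.

(* [(9 / K) ^ m = exp (- 6 m)] with [K = 9 exp 6]. *)
Lemma tail_le (a u : 'cV[R]_n) (ups g : R) (p s : nat) :
  (0 < s)%N -> \sum_i a i 0 ^+ 2 <= 1 -> (forall i, `|u i 0| <= ups) ->
  0 < ups -> 0 < g -> (2 * p * s <= 4 * k)%N ->
  (P [set w | (g * ups * (9 * expR 6 * L) ^+ s <=
               `|(a^T *m trunc_mx H B w ^+ s *m u) 0 0|)%R] <=
   (expR (- 6) ^+ (2 * p * s) / g ^+ (2 * p))%:E)%E.
Proof.
move=> s0 a1 hu ups0 g0 psk.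
apply: (@markov_even _ _ _ _ _ _ _ p).
- exact: bounded_mfun_trunc_mx.
- by rewrite !mulr_gt0// exprn_gt0// !mulr_gt0// expR_gt0.
apply: le_trans (mean_moment_le9 s0 a1 hu psk) _.
rewrite le_eqVlt; apply/orP; left; apply/eqP.
rewrite [(g * ups * _) ^+ _]exprMn (exprMn (2 * p) g ups) -exprM [(s * _)%N]mulnC.
rewrite -[9 * expR 6 * L]mulrA (mulrCA 9) exprMn expRN exprVn.
have e0 : expR (6 : R) ^+ (2 * p * s) != 0 by rewrite expf_neq0// gt_eqF// expR_gt0.
have g0' : g ^+ (2 * p) != 0 by rewrite expf_neq0// gt_eqF.
by field; rewrite e0 g0'.
Qed.

End Tails.

(** For [s = i.+1], the number [k %/ s + 1] is the least [p] with [p * s > k]; it overshoots by at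
    most [s <= k]. *)
Lemma even_moment_steps_le (k i : nat) : (i < k)%N ->
  (2 * (k %/ i.+1).+1 * i.+1 <= 4 * k)%N.
Proof. by have := leq_divM k i.+1; rewrite -mulnA mulSn; lia. Qed.

Lemma second_moment_steps_le (k i : nat) : (0 < k)%N -> (i < k.+1)%N ->
  (2 * 1 * i.+1 <= 4 * k)%N.
Proof. lia. Qed.

Lemma leqS_sqr (n : nat) : (2 <= n)%N -> (n.+1 <= n ^ 2)%N.
Proof. rewrite expnS expn1; nia. Qed.

(** * The event on which all deterministic estimates hold *)

Section GoodEvent.
Variables (R : realType) (d : measure_display) (T : measurableType d)
  (P : probability T R) (n : nat) (H : 'I_n -> 'I_n -> {RV P >-> R})
  (sigma B L : R) (k : nat).
Hypotheses (B0 : 0 <= B) (sigma0 : 0 <= sigma) (L0 : 0 < L)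
  (indep : mutually_independent (fun ij : 'I_n * 'I_n => H ij.1 ij.2))
  (mean0 : forall i j, mean P (fun w => trunc B (H i j w)) = 0)
  (mean2 : forall i j, mean P (fun w => trunc B (H i j w) ^+ 2) <= sigma ^+ 2)
  (n1 : 1 <= ln (n%:R : R)) (kl : ln (n%:R : R) <= k%:R) (kl2 : k%:R <= 2 * ln (n%:R : R))
  (k0 : (0 < k)%N) (kn : (k <= n)%N) (n2 : (2 <= n)%N)
  (sigmaL : sigma ^+ 2 * (n%:R * ln n%:R) <= L ^+ 2) (BL : B * ln n%:R <= L).

Let rho := 9 * expR 6 * L.

Let n0 : 0 < n%:R :> R. Proof. by rewrite ltr0n; apply: leq_trans n2. Qed.

Lemma expRN_exp_le c : expR (- c%:R) ^+ k <= n%:R ^- c :> R.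
Proof.
rewrite expRN exprVn lef_pV2 ?posrE ?exprn_gt0 ?expR_gt0//.
rewrite -{1}(lnK (x := n%:R)) ?posrE// -!expRM_natl ler_expR -natrM mulrC natrM.
by rewrite ler_wpM2r.
Qed.

Lemma random_mxE w : (forall i j, `|H i j w| <= B) -> random_mx H w = trunc_mx H B w.
Proof. by move=> hB; apply/matrixP => i j; rewrite !mxE trunc_id. Qed.

(** The exceptional set joins [E1], for the forms [u^T H^s u], [E2], for the entries of the powers,
    and [E3], for entries of [H] beyond [B]. Off [E3] truncation changes nothing, so the tail bounds
    speak of [H] itself. *)
Lemma good_event (u : 'cV[R]_n) (ups cb : R) :
  0 < ups -> \sum_i u i 0 ^+ 2 <= 1 -> (forall i, `|u i 0| <= ups) ->
  (forall i j, (P [set w | (B < `|H i j w|)%R] <= (cb * n%:R ^- 12)%:E)%E) ->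
  exists E, [/\ measurable E, (P E <= ((cb + 2) * n%:R ^- 10)%:E)%E &
    forall w, ~ E w ->
      (forall s i j, (s <= k.+1)%N ->
         `|(random_mx H w ^+ s) i j| <= n%:R ^+ 7 * rho ^+ s) /\
      (forall s, (0 < s < k.+1)%N ->
         `|(u^T *m random_mx H w ^+ s *m u) 0 0| <= ups * rho ^+ s)].
Proof.
move=> ups0 uu hu hcb.
pose y (a v : 'cV[R]_n) s w := (a^T *m trunc_mx H B w ^+ s *m v) 0 0.
have my a v s : measurable_fun setT (y a v s).
  by case: (bounded_mfun_trunc_mx H B0 s a v).
(* Moments of order [2 * p] with [p * s >= k] give probability at most [exp (- 12 k) <= n^-12] for
   each of the [k] forms. *)
have [E1 [mE1 sE1 PE1]] : exists E, [/\ measurable E,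
    forall i : 'I_k, [set w | 1 * ups * rho ^+ i.+1 <= `|y u u i.+1 w|] `<=` E &
    (P E <= (#|'I_k|%:R * n%:R ^- 12)%:E)%E].
  apply: union_bound => i; first exact: measurable_norm_ge.
  have hp := even_moment_steps_le (ltn_ord i).
  apply: le_trans (tail_le B0 sigma0 L0 indep mean0 mean2 n1 kl2 sigmaL BL
    (isT : (0 < i.+1)%N) uu hu ups0 ltr01 hp) _.
  rewrite lee_fin expr1n divr1; apply: le_trans (expRN_exp_le 12).
  rewrite (_ : - 12%:R = 2%:R * - 6 :> R); last by ring.
  rewrite expRM_natl -exprM ler_wiXn2l ?expR_ge0//.
  by rewrite -mulnA leq_mul2l /= ltnW// ltn_ceil.
(* Second moments suffice: the slack [n^7] gives [n^-14] for each entry, against at most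
   [(k + 1) n^2 <= n^4] entries in all. *)
have [E2 [mE2 sE2 PE2]] : exists E, [/\ measurable E,
    forall e : 'I_k.+1 * ('I_n * 'I_n), [set w | n%:R ^+ 7 * 1 * rho ^+ e.1.+1 <=
       `|y (delta_mx e.2.1 0) (delta_mx e.2.2 0) e.1.+1 w|] `<=` E &
    (P E <= (#|{: 'I_k.+1 * ('I_n * 'I_n)}|%:R * n%:R ^- 14)%:E)%E].
  apply: union_bound => e; first exact: measurable_norm_ge.
  have hp := second_moment_steps_le k0 (ltn_ord e.1).
  apply: le_trans (tail_le B0 sigma0 L0 indep mean0 mean2 n1 kl2 sigmaL BL
    (isT : (0 < e.1.+1)%N) _ _ ltr01 _ hp) _.
  - rewrite (bigD1 e.2.1)//= mxE !eqxx /= expr1n big1 ?addr0// => i /negbTE ie.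
    by rewrite mxE ie /= expr0n.
  - by move=> i; rewrite mxE; case: (_ && _); rewrite ?normr1 ?normr0.
  - by rewrite exprn_gt0.
  rewrite lee_fin -exprM -[leRHS]mul1r ler_wpM2r ?invr_ge0 ?exprn_ge0//.
have [E3 [mE3 sE3 PE3]] : exists E, [/\ measurable E,
    forall e : 'I_n * 'I_n, [set w | B < `|H e.1 e.2 w|] `<=` E &
    (P E <= (#|{: 'I_n * 'I_n}|%:R * (cb * n%:R ^- 12))%:E)%E].
  apply: union_bound => e; last exact: hcb.
  rewrite (_ : mkset _ = (@Num.norm R R \o H e.1 e.2) @^-1` `]B, +oo[%classic); last first.
    by apply/seteqP; split => w /=; rewrite in_itv /= andbT.
  by rewrite -[X in measurable X]setTI; apply: measurableT_comp.
exists (E1 `|` E2 `|` E3); split.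
- by apply: measurableU => //; apply: measurableU.
- apply: le_trans (measureU2 _ _ _) _ => //; first exact: measurableU.
  apply: le_trans (leeD (measureU2 _ _ _) (lexx _)) _ => //.
  apply: le_trans (leeD (leeD PE1 PE2) PE3) _.
  rewrite -!EFinD lee_fin !card_prod !card_ord !natrM.
  have h1 : k%:R * n%:R ^- 12 <= n%:R ^- 10 :> R.
    rewrite ler_pdivrMr ?exprn_gt0// (exprD _ 10 2) mulKf ?expf_neq0 ?gt_eqF//.
    by rewrite -natrX ler_nat; apply: leq_trans kn _; rewrite expnS leq_pmulr// ltnW.
  have h2 : k.+1%:R * (n%:R * n%:R) * n%:R ^- 14 <= n%:R ^- 10 :> R.
    rewrite ler_pdivrMr ?exprn_gt0// (exprD _ 10 4) mulKf ?expf_neq0 ?gt_eqF//.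
    rewrite (exprD _ 2 2) -expr2 ler_wpM2r ?exprn_ge0//.
    by rewrite -natrX ler_nat; apply: leq_trans (leqS_sqr n2); rewrite ltnS.
  have h3 : n%:R * n%:R * (cb * n%:R ^- 12) = cb * n%:R ^- 10 :> R.
    by rewrite (exprD _ 10 2); field; rewrite gt_eqF.
  by rewrite h3; lra.
- move=> w /not_orP[/not_orP[w1 w2] w3].
  have hB i j : `|H i j w| <= B.
    by rewrite leNgt; apply/negP => h; apply: w3; apply: (sE3 (i, j)).
  rewrite random_mxE//; split=> [s i j|s /andP[s0 sk]].
    (* The power 0 is the identity matrix; [E2] only covers exponents from 1 on. *)
    case: s => [_|s sk].
      rewrite expr0 mulr1 mxE; apply: le_trans (_ : 1 <= _).
        by case: (_ == _); rewrite ?normr1 ?normr0.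
      by rewrite exprn_ege1// ler1n; apply: leq_trans n2.
    apply/ltW; rewrite ltNge; apply/negP => h; apply: w2.
    apply: (sE2 (Ordinal sk, (i, j))) => /=; rewrite mulr1 /y.
    by rewrite trmx_delta -rowE -colE !mxE.
  apply/ltW; rewrite ltNge; apply/negP => h; apply: w1.
  case: s s0 sk h => // s _ sk h.
  by apply: (sE1 (Ordinal (sk : (s < k)%N))); rewrite /= mul1r.
Qed.

End GoodEvent.

(** * Conclusion *)

(** These are the smallness conditions for [b = n^7] and [N = k + 1]. The bound [q ^+ k <= n^-20]
    beats [n^3 b^2 = n^17] and leaves [4 n^-3], at most [n^-1] as [n >= 2]; [12 * q <= 1] follows
    from [exp 20 >= 21]. *)
Lemma small_ratio_bounds (R : realType) (n k : nat) (q ups : R) :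
  (2 <= n)%N -> 0 <= q -> q <= expR (- 20) ->
  expR (- 20) ^+ k <= n%:R ^- 20 :> R -> n%:R^-1 <= ups ->
  [/\ 12 * q <= 1, 2 * (n%:R * n%:R ^+ 7 * q ^+ k.+1) <= 1 &
     4 * (n%:R ^+ 3 * (n%:R ^+ 7) ^+ 2 * q ^+ k) <= ups].
Proof.
move=> n2 q0 qe ek hups; set x : R := n%:R in ek hups *.
have x2 : 2 <= x by rewrite (ler_nat R 2).
have x0 : 0 < x by apply: lt_le_trans x2.
have e20 : 21 * expR (- 20) <= 1 :> R.
  rewrite expRN ler_pdivrMr ?expR_gt0// mul1r.
  by apply: le_trans (expR_ge1Dx 20); rewrite -natr1 addrC.
have q1 : 12 * q <= 1 by move: e20 qe q0; lra.
have qk : q ^+ k <= x ^- 20 by apply: le_trans ek; rewrite lerXn2r// nnegrE expR_ge0.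
have qk0 : 0 <= q ^+ k by rewrite exprn_ge0.
have v0 : 0 <= x^-1 by rewrite invr_ge0 ltW.
have v2 : 2 * x^-1 <= 1 by rewrite ler_pdivrMr// mul1r.
have v1 : x^-1 <= 1 by lra.
split=> //.
- have h : x * x ^+ 7 * q ^+ k <= x^-1.
    apply: le_trans (_ : x * x ^+ 7 * x ^- 20 <= _).
      by rewrite ler_wpM2l// mulr_ge0 ?exprn_ge0 ?(ltW x0).
    rewrite (_ : x * x ^+ 7 * x ^- 20 = x^-1 * x^-1 ^+ 11).
      by rewrite ler_piMr// exprn_ile1.
    by rewrite exprVn; field; rewrite gt_eqF.
  rewrite (exprS q) [x * x ^+ 7 * _]mulrCA; have : q * (x * x ^+ 7 * q ^+ k) <= 1 * x^-1.
    by apply: ler_pM => //; [rewrite !mulr_ge0 ?exprn_ge0 ?(ltW x0)|lra].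
  lra.
- apply: le_trans hups.
  have h : x ^+ 3 * (x ^+ 7) ^+ 2 * q ^+ k <= x^-1 * (x^-1 * x^-1).
    apply: le_trans (_ : x ^+ 3 * (x ^+ 7) ^+ 2 * x ^- 20 <= _).
      by rewrite ler_wpM2l// mulr_ge0 ?exprn_ge0 ?(ltW x0).
    by rewrite le_eqVlt; apply/orP; left; apply/eqP; field; rewrite gt_eqF.
  have : (2 * x^-1) * (2 * x^-1) <= 1 * 1 by rewrite ler_pM// mulr_ge0.
  have h2 := ler_wpM2l v0 => /h2; lra.
Qed.

Lemma entry_le_mx_norm (R : realType) (n : nat) (u : 'cV[R]_n) i : `|u i 0| <= `|u|.
Proof.
rewrite -[`|u|]/(mx_norm u) mx_normrE.
exact: (@le_bigmax _ _ _ 0 (fun ij : 'I_n * 'I_1 => `|u ij.1 ij.2|) (i, 0)).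
Qed.

(** If [ups < 1 / n], the squares of the entries would sum to at most [ups < 1]. The upper bound
    compares [mu] with the value [n], admissible since the entries of a unit vector are at most
    1. *)
Lemma incoherence_bounds (R : realType) (n : nat) (u : 'cV[R]_n) (mu : R) :
  (0 < n)%N -> \sum_i u i 0 ^+ 2 = 1 -> is_incoherence u mu ->
  [/\ forall i, `|u i 0| <= Num.sqrt (mu / n%:R), n%:R^-1 <= Num.sqrt (mu / n%:R) &
      Num.sqrt (mu / n%:R) <= 1].
Proof.
move=> n0 uu [hmu mu_min]; set ups := Num.sqrt _.
have x0 : 0 < n%:R :> R by rewrite ltr0n.
have hu i : `|u i 0| <= ups by apply: le_trans (entry_le_mx_norm u i) hmu.
have u1 i : `|u i 0| <= 1.
  rewrite -(@ler_pXn2r _ 2)// ?nnegrE// real_normK ?num_real// expr1n -uu.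
  by rewrite (bigD1 i)//= lerDl sumr_ge0// => j _; apply: sqr_ge0.
split=> //.
- have ups0 : 0 <= ups by apply: sqrtr_ge0.
  rewrite leNgt; apply/negP => lt_ups.
  have : \sum_i u i 0 ^+ 2 <= \sum_(i < n) (n%:R^-1 * ups).
    apply: ler_sum => i _; rewrite -real_normK ?num_real// expr2.
    by apply: ler_pM => //; apply: le_trans (hu i) (ltW lt_ups).
  rewrite uu sumr_const card_ord -[leRHS]mulr_natl mulrA divff ?gt_eqF// mul1r leNgt.
  by rewrite (lt_le_trans lt_ups)// invf_le1// ler1n.
- rewrite -[leRHS]sqrtr1 ler_wsqrtr// ler_pdivrMr// mul1r; apply: mu_min.
  rewrite divff ?gt_eqF// sqrtr1 -[`|u|]/(mx_norm u) mx_normrE.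
  by apply/bigmax_leP; split=> // -[i j] _; rewrite /= (ord1 j).
Qed.

Theorem corollary1 (R : realType) (cb : R) (hcb : 0 < cb) :
  exists c1 C C' : R, [/\ 0 < c1, 0 < C, 0 < C' &
    forall (n : nat) (lambdastar : R) (ustar : 'cV[R]_n) (mu sigma B : R)
      (d : measure_display) (T : measurableType d) (P : probability T R)
      (H : 'I_n -> 'I_n -> {RV P >-> R}),
      lambdastar != 0 -> l2norm ustar = 1 -> is_incoherence ustar mu ->
      0 <= sigma -> 0 < B ->
      noise_assumption cb sigma B H ->
      noise_level n sigma B <= c1 * `|lambdastar| ->
      with_probability_at_least P (1 - C' * n%:R ^- 10)
        [set w | forall lambda : R[i],
          leading_eigenvalue (rank1_mx lambdastar ustar + random_mx H w)
            lambda ->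
          `|lambda - lambdastar%:C| <=
            (C * noise_level n sigma B * Num.sqrt (mu / n%:R))%:C]].
Proof.
pose K : R := 9 * expR 6; have K0 : 0 < K by rewrite mulr_gt0// expR_gt0.
pose n0 := (Num.truncn (expR 1 : R)).+1.
(* The first constant makes [2 K L / |l|] at most [exp (- 20)], the second comes from
   [6 * ups * rho] with [rho = K L], and in the third [n0 ^+ 10] makes the claim void for small
   [n]. *)
exists (expR (- 20) / (2 * K)), (6 * K), (cb + 2 + n0%:R ^+ 10).
have n0p : 0 <= n0%:R ^+ 10 :> R by rewrite exprn_ge0.
split; rewrite ?divr_gt0 ?mulr_gt0 ?expR_gt0//; first lra.
move=> n l u mu sigma B d T P H l0 u1 hmu sigma0 B0 [indep EH VH tailH] hL.
have uu : \sum_i u i 0 ^+ 2 = 1.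
  move: u1; rewrite /l2norm => u1.
  rewrite -[LHS]sqr_sqrtr ?u1 ?expr1n//.
  by apply: sumr_ge0 => i _; apply: sqr_ge0.
have n_gt0 : (0 < n)%N.
  rewrite lt0n; apply/negP => /eqP n_eq0; subst n.
  by move: uu; rewrite big_ord0 => /eqP; rewrite eq_sym oner_eq0.
have x0 : 0 < n%:R :> R by rewrite ltr0n.
(* For [n < e] the required probability is not positive, and the empty event will do. *)
have [ln1|ln1] := ltP (ln n%:R : R) 1.
  exists set0; split=> //; rewrite measure0 lee_fin subr_le0 ler_pdivlMr ?exprn_gt0//.
  rewrite mul1r; apply: le_trans (_ : n0%:R ^+ 10 <= _); last by lra.
  rewrite lerXn2r ?nnegrE//; apply: le_trans (ltW (truncnS_gt _)).
  by rewrite -(lnK (x := n%:R)) ?posrE// ler_expR ltW.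
have n2 : (2 <= n)%N.
  rewrite ltn_neqAle n_gt0 andbT; apply/negP => /eqP n1.
  by move: ln1; rewrite -n1 ln1 ler10.
have ln0 : 0 <= ln n%:R :> R by apply: le_trans ln1.
(* An integer between [ln n] and [2 * ln n], the upper bound because [ln n >= 1]. *)
pose k := (Num.truncn (ln n%:R : R)).+1.
have kl : ln n%:R <= k%:R :> R by apply/ltW/truncnS_gt.
have kl2 : k%:R <= 2 * ln n%:R :> R.
  have /andP[h _] := truncn_itv ln0.
  by rewrite /k -natr1; lra.
have kn : (k <= n)%N by rewrite truncn_lt_nat// ln_sublinear.
pose L := noise_level n sigma B.
have BL : B * ln n%:R <= L by rewrite le_max lexx orbT.
have L0 : 0 < L by apply: lt_le_trans BL; rewrite mulr_gt0// (lt_le_trans _ ln1).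
have sigmaL : sigma ^+ 2 * (n%:R * ln n%:R) <= L ^+ 2.
  have h : sigma * Num.sqrt (n%:R * ln n%:R) <= L by rewrite le_max lexx.
  have h0 : 0 <= n%:R * ln n%:R :> R by rewrite mulr_ge0.
  rewrite -[X in _ * X](sqr_sqrtr h0) -exprMn lerXn2r ?nnegrE ?(ltW L0)//.
  by rewrite mulr_ge0 ?sqrtr_ge0.
have Bge0 := ltW B0.
have mean0 i j : mean P (fun w => trunc B (H i j w)) = 0.
  case: (tailH i j) => [ae|[sym _]]; first exact: mean_trunc_bounded.
  exact: mean_trunc_symmetric.
have mean2 i j : mean P (fun w => trunc B (H i j w) ^+ 2) <= sigma ^+ 2.
  exact: mean_trunc_sqr_le.
(* In the bounded case the event is null, so both forms of the noise assumption yield the same tail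
   bound. *)
have tail i j : (P [set w | (B < `|H i j w|)%R] <= (cb * n%:R ^- 12)%:E)%E.
  case: (tailH i j) => [ae|[_ //]].
  have mA : measurable [set w | B < `|H i j w|].
    rewrite (_ : mkset _ = (@Num.norm R R \o H i j) @^-1` `]B, +oo[%classic); last first.
      by apply/seteqP; split => w /=; rewrite in_itv /= andbT.
    by rewrite -[X in measurable X]setTI; apply: measurableT_comp.
  have -> : P [set w | (B < `|H i j w|)%R] = 0%E.
    have neg : P.-negligible [set w | B < `|H i j w|].
      by apply: negligibleS ae => w /= h; apply/negP; rewrite -ltNge.
    exact: (proj1 (negligibleP P mA) neg).
  by rewrite lee_fin divr_ge0 ?exprn_ge0// ltW.
have [hu ups_ge ups_le1] := incoherence_bounds n_gt0 uu hmu.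
set ups := Num.sqrt (mu / n%:R) in hu ups_ge ups_le1 *.
have ups0 : 0 < ups by apply: lt_le_trans ups_ge; rewrite invr_gt0.
have uu1 : \sum_i u i 0 ^+ 2 <= 1 by rewrite uu.
have [E [mE PE goodE]] := good_event Bge0 sigma0 L0 indep mean0 mean2 ln1 kl kl2
  isT kn n2 sigmaL BL ups0 uu1 hu tail.
exists (~` E); split.
- exact: measurableC.
- move=> w nEw lambda hlambda; have [hA hy] := goodE w nEw.
  have rho0 : 0 <= K * L by rewrite mulr_ge0 ?ltW.
  pose q := 2 * (K * L) / `|l|.
  have q0 : 0 <= q by rewrite divr_ge0// mulr_ge0.
  have qe : q <= expR (- 20).
    rewrite ler_pdivrMr ?normr_gt0//.
    have := ler_wpM2l (ltW (mulr_gt0 (ltr0n R 2) K0)) hL.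
    rewrite -/L -[in leLHS]mulrA => /le_trans; apply; rewrite le_eqVlt; apply/orP; left.
    by apply/eqP; field; rewrite gt_eqF.
  have [q12 qN qN1] := small_ratio_bounds n2 q0 qe (expRN_exp_le kl n2 20) ups_ge.
  have u1' i : `|u i 0| <= 1 by apply: le_trans (hu i) ups_le1.
  have uu' : (u^T *m u) 0 0 = 1.
    by rewrite mxE -uu; apply: eq_bigr => i _; rewrite mxE expr2.
  have b1 : 1 <= n%:R ^+ 7 :> R by rewrite exprn_ege1// ler1n.
  have := rank1_leading_eigenvalue l0 (isT : (0 < k.+1)%N) b1 rho0 (ltW ups0)
    ups_le1 q12 qN qN1 uu' u1' hA hy hlambda.
  by rewrite -/L -/ups (_ : 6 * ups * (K * L) = 6 * K * L * ups)//; ring.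
- rewrite probability_setC//; apply: le_trans (leeB (lexx 1%E) PE).
  rewrite -EFinB lee_fin lerD2l lerN2 ler_wpM2r ?invr_ge0 ?exprn_ge0//.
  by rewrite lerDl.
Qed.
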